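(* Let $l/\mathbb{Q}$ be a finite Galois extension with positive unit rank $r=r(l)$. Let $\eta_1,\dots,\eta_r$ be multiplicatively independent elements of $F_l$, and let $\mathfrak A=\langle\eta_1,\dots,\eta_r\rangle\subseteq F_l$. Then there exists a Minkowski unit $\beta\in\mathfrak A$ such that $$h(\beta)\le 2\sum_{j=1}^r h(\eta_j),$$ and the subgroup $\mathfrak B=\langle\sigma(\beta):\sigma\in\mathrm{Aut}(l/\mathbb{Q})\rangle\subseteq F_l$ has finite index satisfying $$\mathrm{Reg}(l)\,[F_l:\mathfrak B]\le\bigl([l:\mathbb{Q}]\,h(\beta)\bigr)^r,$$ where $\mathrm{Reg}(l)$ is the regulator of $l$.
   Context: For a number field $l$, $O_l^\times$ is the unit group of its ring of integers, $\mathrm{Tor}(O_l^\times)$ the group of roots of unity in $l$, and $F_l=O_l^\times/\mathrm{Tor}(O_l^\times)$, a free abelian group whose rank $r(l)$ is the unit rank of $l$; elements of $F_l$ are written via coset representatives. $\mathrm{Aut}(l/\mathbb{Q})$ acts on $F_l$. For each place $w$ of $l$, $\|\cdot\|_w$ denotes the absolute value in $w$ extending the usual (archimedean or $p$-adic) absolute value of $\mathbb{Q}$, and $|\cdot|_w=\|\cdot\|_w^{d_w/d}$ where $d_w=[l_w:\mathbb{Q}_w]$ is the local degree and $d=[l:\mathbb{Q}]$. The absolute logarithmic Weil height is $h(\alpha)=\sum_w\log^+|\alpha|_w$ (sum over all places of $l$); it is well defined on $F_l$. An element $\beta\in F_l$ is a Minkowski unit if the subgroup of $F_l$ generated by $\{\sigma(\beta):\sigma\in\mathrm{Aut}(l/\mathbb{Q})\}$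 has rank $r(l)$. *)

(* Defs.v *)
(* MathComp (number fields, Galois groups, algC) + Stdlib Reals (logarithms). *)
From Stdlib Require Import Reals ZArith ClassicalEpsilon.
From HB Require Import structures.
From mathcomp Require Import all_boot all_order all_algebra all_fingroup all_field.
Set Implicit Arguments. Unset Strict Implicit. Unset Printing Implicit Defensive.
Import Order.TTheory GRing.Theory Num.Theory.
Local Open Scope ring_scope.

(* ---------- Transfer from algC to the Stdlib reals ---------- *)
Definition int2Z (z : int) : Z :=
  match z with Posz n => Z.of_nat n | Negz n => Z.opp (Z.of_nat n.+1) end.
Definition Q2R (q : rat) : R := Rdiv (IZR (int2Z (numq q))) (IZR (int2Z (denq q))).
(* real number represented by the real part of z : supremum of rationals below 'Re z *)
Definition toR (z : algC) : R :=
  epsilon (inhabits R0) (is_lub (fun y : R => exists q : rat, ratr q <= 'Re z /\ y = Q2R q)).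
Definition lnplus (x : R) : R := Rmax R0 (ln x).

(* ---------- Units of the ring of integers, roots of unity ---------- *)
Definition is_alg_int (L : fieldExtType rat) (x : L) : Prop :=
  exists p : {poly int}, p \is monic /\ root (map_poly (fun z : int => z%:~R) p) x.
Definition is_OK_unit (L : fieldExtType rat) (x : L) : Prop :=
  is_alg_int x /\ x != 0 /\ is_alg_int x^-1.
Definition is_root_of_unity (L : fieldExtType rat) (x : L) : Prop :=
  exists n : nat, (0 < n)%N /\ x ^+ n = 1.

(* Elements of F_l are represented by units (coset representatives). *)
(* Multiplicative independence in F_l (i.e. modulo torsion). *)
Definition mult_indep (L : fieldExtType rat) (I : finType) (g : I -> L) : Prop :=
  forall k : I -> int, is_root_of_unity (\prod_(i : I) g i ^ k i) -> forall i, k i = 0.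
(* Membership in the subgroup of F_l generated by the classes of the g i. *)
Definition in_gen (L : fieldExtType rat) (I : finType) (g : I -> L) (x : L) : Prop :=
  is_OK_unit x /\ exists k : I -> int, is_root_of_unity (x / \prod_(i : I) g i ^ k i).
(* A subgroup P of F_l (given as a torsion-saturated predicate on units) has rank s. *)
Definition sub_rank (L : fieldExtType rat) (P : L -> Prop) (s : nat) : Prop :=
  (exists y : 'I_s -> L, (forall j, P (y j)) /\ mult_indep y) /\
  (forall y : 'I_s.+1 -> L, (forall j, P (y j)) -> ~ mult_indep y).
(* r(l) : the rank of F_l. *)
Definition unit_rank (L : fieldExtType rat) (r : nat) : Prop := sub_rank (@is_OK_unit L) r.
(* [F_l : P] = n. *)
Definition has_index (L : fieldExtType rat) (P : L -> Prop) (n : nat) : Prop :=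
  exists reps : 'I_n -> L, (forall i, is_OK_unit (reps i)) /\
    (forall i j, P (reps i / reps j) -> i = j) /\
    (forall u, is_OK_unit u -> exists i, P (u / reps i)).

(* ---------- Galois extensions of Q ---------- *)
(* A finite Galois extension of Q is a splittingFieldType rat (normal, char 0). *)
Definition GalQ (L : splittingFieldType rat) := gal_of (fullv : {vspace L}).
(* Minkowski unit *)
Definition minkowski_unit (L : splittingFieldType rat) (r : nat) (b : L) : Prop :=
  is_OK_unit b /\ sub_rank (in_gen (fun s : GalQ L => s b)) r.

(* ---------- Weil height (for units: only archimedean places contribute) ---------- *)
(* The embeddings L -> algC are the iota o s, s in GalQ L; each archimedean place w
   corresponds to d_w embeddings, so sum_w log^+ |a|_w = (1/d) sum_s log^+ |iota (s a)|. *)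
Definition weil_h (L : splittingFieldType rat) (iota : {rmorphism L -> algC}) (a : L) : R :=
  Rdiv (\big[Rplus/R0]_(s : GalQ L) lnplus (toR `|iota (s a)|)) (INR (\dim (fullv : {vspace L}))).

(* ---------- Regulator ---------- *)
Definition detR (n : nat) (M : 'I_n -> 'I_n -> R) : R :=
  \big[Rplus/R0]_(s : 'S_n)
     Rmult (if odd_perm s then Ropp R1 else R1) (\big[Rmult/R1]_(i < n) M i (s i)).
Definition real_emb (L : fieldExtType rat) (t : {rmorphism L -> algC}) : Prop :=
  forall x, (t x)^* = t x.
(* local degree d_w of the archimedean place of t *)
Definition loc_deg (L : fieldExtType rat) (t : {rmorphism L -> algC}) : R :=
  if excluded_middle_informative (real_emb t) then R1 else INR 2.
(* t1, t2 define distinct archimedean places *)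
Definition distinct_places (L : fieldExtType rat) (t1 t2 : {rmorphism L -> algC}) : Prop :=
  (exists x, t1 x <> t2 x) /\ (exists x, t1 x <> (t2 x)^*).
Definition fundamental_system (L : fieldExtType rat) (r : nat) (e : 'I_r -> L) : Prop :=
  (forall j, is_OK_unit (e j)) /\ mult_indep e /\ (forall u, is_OK_unit u -> in_gen e u).
Definition is_regulator (L : fieldExtType rat) (Rg : R) : Prop :=
  exists (r : nat) (e : 'I_r -> L) (t : 'I_r -> {rmorphism L -> algC}),
    fundamental_system e /\ (forall i j, i <> j -> distinct_places (t i) (t j)) /\
    Rg = Rabs (detR (fun i j => Rmult (loc_deg (t i)) (ln (toR `|t i (e j)|)))).
Definition regulator (L : fieldExtType rat) : R := epsilon (inhabits R0) (@is_regulator L).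

(* Main.v *)
(* Let [G] be the Galois group and [c] in [G] the complex conjugation attached
   to [iota]; the archimedean places are the cosets [s {1, c}].  Put
   [l_s(u) = log |iota (s u)|], a vector of sum zero for a unit [u].

   Call a unit contracting if [l_s(u) < 0] for every [s] outside [{1, c}].  A
   pigeonhole argument produces one, and its conjugates have a log matrix with
   negative off-diagonal entries and positive row sums.  For such a matrix
   [0 < det <= prod of the diagonal], so the conjugates are independent; this is
   Dirichlet's unit theorem, and it also makes the logs of the [eta j] a basis
   of the trace-zero space.

   Take the vector with entries [- sum_j |l_s(eta_j)| / 2 - delta] off [{1, c}]
   and round its coordinates in this basis to integers: each entry moves by at
   most [sum_j |l_s(eta_j)| / 2], so the resulting unit [beta] is contracting,
   and its height, carried by the single place [{1, c}], is at most
   [2 sum_j h(eta_j)].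

   If [r] conjugates of [beta] are written in a fundamental system through an
   integer matrix [N], then [Reg |det N|] is their log determinant, bounded by
   the product of the diagonal, which is [(d h(beta))^r].  The index of the
   group generated by all the conjugates is at most [|det N|]. *)
Require Import Defs.
From Stdlib Require Import Reals ClassicalEpsilon.
From mathcomp Require Import all_boot all_order all_algebra all_fingroup all_field.
From mathcomp Require Import ring lra zify Rstruct reals.
Set Implicit Arguments. Unset Strict Implicit. Unset Printing Implicit Defensive.
Import Order.TTheory GRing.Theory Num.Theory.
Local Open Scope ring_scope.

(** * Determinants of diagonally dominant matrices *)

Lemma diag_gt0 (F : realFieldType) (n : nat) (A : 'M[F]_n) :
  (forall i j, i != j -> A i j <= 0) -> (forall i, 0 < \sum_j A i j) ->
  forall i, 0 < A i i.
Proof.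
move=> off rows i; apply: lt_le_trans (rows i) _; rewrite (bigD1 i) //= gerDl.
by apply: sumr_le0 => j ji; rewrite off // eq_sym.
Qed.

(** Gaussian elimination: clearing the first column leaves the Schur complement [D] of the corner
    [a], which inherits the sign and row-sum hypotheses and has diagonal entries at most those of
    [A]. Induction gives both bounds. *)
Lemma det_offdiag_le0 (F : realFieldType) (n : nat) (A : 'M[F]_n) :
  (forall i j, i != j -> A i j <= 0) -> (forall i, 0 < \sum_j A i j) ->
  0 < \det A <= \prod_i A i i.
Proof.
elim: n A => [|n IHn] A off rows; first by rewrite det_mx00 big_ord0 ltr01 lexx.
set a := A 0 0; have rows0 := rows 0.
rewrite big_ord_recl -/a in rows0.
have b_le0 j : A 0 (lift ord0 j) <= 0 by apply: off.
have c_le0 i : A (lift ord0 i) 0 <= 0 by apply: off.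
have a_gt0 : 0 < a.
  exact: diag_gt0.
pose D : 'M[F]_n := \matrix_(i, j)
  (A (lift ord0 i) (lift ord0 j) - A (lift ord0 i) 0 * A 0 (lift ord0 j) / a).
have detA : \det A = a * \det D.
  pose A' : 'M[F]_(1 + n) := A.
  (* The unimodular [E] clears the column below [a]: the product [E *m A'] is block upper triangular
     with diagonal blocks [a] and [D]. *)
  pose E : 'M[F]_(1 + n) := block_mx 1 0 (- a^-1 *: dlsubmx A') 1%:M.
  have ulE : ulsubmx A' = a%:M.
    apply/matrixP=> i j; rewrite !ord1 !mxE eqxx mulr1n.
    by congr (A _ _); apply/val_inj.
  have : \det (E *m A') = \det A.
    by rewrite det_mulmx det_lblock !det1 !mul1r.
  rewrite -[A']submxK /E mulmx_block !mul1mx !mul0mx !addr0 ulE.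
  rewrite mul_mx_scalar scalerA mulrN mulfV ?gt_eqF // scaleN1r addNr.
  rewrite det_ublock det_scalar expr1 => <-; congr (_ * \det _).
  apply/matrixP=> i j; rewrite !mxE big_ord1 !mxE.
  rewrite !rshift1 (_ : lshift n (0 : 'I_1) = (0 : 'I_n.+1)); last exact/val_inj.
  by field; rewrite gt_eqF.
have D_off : forall i j, i != j -> D i j <= 0.
  move=> i j ne; rewrite mxE.
  have h1 : A (lift ord0 i) (lift ord0 j) <= 0.
    by apply: off; rewrite (inj_eq lift_inj).
  have h2 : 0 <= A (lift ord0 i) 0 * A 0 (lift ord0 j) / a.
    by rewrite divr_ge0 ?(ltW a_gt0) // mulr_le0.
  by lra.
have D_rows i : 0 < \sum_j D i j.
  under eq_bigr do rewrite mxE.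
  rewrite big_split /=.
  have := rows (lift ord0 i); rewrite big_ord_recl.
  set s := \sum_i0 _; set b := \sum_i0 _ in rows0 *; set c := A _ _.
  move=> h; apply: lt_le_trans h _; rewrite sumrN -mulr_suml -mulr_sumr -/b -/s -/c -subr_le0.
  (* The new row sum exceeds the old one [c + s] by [- c (a + b) / a], which is nonnegative since
     [c <= 0 < a + b]. *)
  have -> : c + s - (s - c * b / a) = c * (a + b) / a by field; rewrite gt_eqF.
  by rewrite pmulr_lle0 ?invr_gt0 // (mulr_le0_ge0 (c_le0 i) (ltW rows0)).
have /andP[D_gt0 D_le] := IHn D D_off D_rows.
rewrite detA mulr_gt0 //= big_ord_recl ler_pM2l //.
apply: le_trans D_le _; apply: ler_prod => i _.
rewrite ltW ?(diag_gt0 D_off) //= mxE gerDl oppr_le0.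
by rewrite divr_ge0 ?(ltW a_gt0) // mulr_le0.
Qed.

(** * The embedding of the real algebraic numbers into the reals *)

Lemma Q2RE (q : rat) : Defs.Q2R q = ratr q.
Proof.
have int2ZE z : IZR (int2Z z) = z%:~R.
  case: z => n /=; first by rewrite -INR_IZR_INZ INRE.
  by rewrite NegzE mulrNz -[(Z.neg _)]/(Z.opp (Z.of_nat n.+1)) opp_IZR -INR_IZR_INZ INRE.
by rewrite /Defs.Q2R !int2ZE RdivE.
Qed.

Lemma algC_real_archi (x : algC) : x \is Num.real -> exists n : nat, x < n%:R.
Proof. by move=> xr; exists (Num.truncn x).+1; apply: real_truncnS_gt. Qed.

Lemma rat_dense_algC (x y : algC) : x \is Num.real -> y \is Num.real -> x < y ->
  exists q : rat, x < ratr q < y.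
Proof.
move=> xr yr xy.
have [n hn] : exists n : nat, (y - x)^-1 < n%:R.
  by apply: algC_real_archi; rewrite rpredV rpredB.
have d_gt0 : 0 < y - x by rewrite subr_gt0.
have n_gt0 : 0 < n%:R :> algC by apply: lt_trans hn; rewrite invr_gt0.
have nxr : n%:R * x \is Num.real by rewrite rpredM ?realn.
have /andP[h1 h2] := real_floor_itv nxr.
(* As [n > 1 / (y - x)], the first multiple of [1 / n] beyond [x] still lies below [y]. *)
exists ((Num.floor (n%:R * x) + 1)%:~R / n%:R).
rewrite fmorph_div /= ratr_int ratr_nat ltr_pdivlMr // ltr_pdivrMr //.
rewrite mulrC h2 /= rmorphD /=; apply: le_lt_trans (lerD h1 (lexx _)) _.
by rewrite mulrC -ltrBrDl -mulrBl -ltr_pdivrMl // mulr1.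
Qed.

(** The set of rationals below [z] is nonempty and bounded because [algC] is archimedean, so the
    [epsilon] defining [toR] does select a least upper bound. *)
Lemma toR_lub (z : algC) : z \is Num.real ->
  is_lub (fun y : R => exists q : rat, ratr q <= z /\ y = ratr q) (toR z).
Proof.
move=> zr.
have -> : (fun y : R => exists q : rat, ratr q <= z /\ y = ratr q) =
          (fun y : R => exists q : rat, ratr q <= 'Re z /\ y = Defs.Q2R q).
  apply/boolp.funext=> y; apply/boolp.propext; rewrite (Creal_ReP z _) //.
  by split=> -[q]; rewrite ?Q2RE => h; exists q; rewrite ?Q2RE.
apply: epsilon_spec.
have [||m h] := completeness (fun y : R => exists q : rat, ratr q <= 'Re z /\ y = Defs.Q2R q); last by exists m.
  have [n hn] := algC_real_archi zr.
  exists n%:R => y [q []]; rewrite (Creal_ReP z _) // => hq ->; rewrite Q2RE.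
  apply/RleP; rewrite -(ratr_nat _ n) ler_rat -(ler_rat algC) ratr_nat.
  exact: le_trans hq (ltW hn).
have [n hn] := @algC_real_archi (- z) ltac:(by rewrite rpredN).
exists (ratr (- n%:R)), (- n%:R); split; last by rewrite Q2RE.
by rewrite (Creal_ReP z _) // rmorphN /= ratr_nat lerNl ltW.
Qed.

Lemma toR_ge_rat (z : algC) (q : rat) :
  z \is Num.real -> ratr q <= z -> ratr q <= toR z.
Proof. by move=> zr qz; apply/RleP; apply: (toR_lub zr).1; exists q. Qed.

Lemma toR_le_rat (z : algC) (q : rat) :
  z \is Num.real -> z <= ratr q -> toR z <= ratr q.
Proof.
move=> zr qz; apply/RleP; apply: (toR_lub zr).2 => y [p [pz ->]].
by apply/RleP; rewrite ler_rat -(ler_rat algC) (le_trans pz).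
Qed.

Lemma toR_lt (x y : algC) : x \is Num.real -> y \is Num.real -> x < y ->
  toR x < toR y.
Proof.
move=> xr yr xy; have [p /andP[xp py]] := rat_dense_algC xr yr xy.
have [|q /andP[pq qy]] := rat_dense_algC _ yr py; first exact: Creal_Crat (Crat_rat p).
apply: le_lt_trans (toR_le_rat xr (ltW xp)) _.
apply: lt_le_trans (toR_ge_rat yr (ltW qy)).
by rewrite ltr_rat -(ltr_rat algC).
Qed.

Lemma ltr_toR (x y : algC) : x \is Num.real -> y \is Num.real ->
  (toR x < toR y) = (x < y).
Proof.
move=> xr yr; have [xy|yx|->] := real_ltgtP xr yr; last by rewrite ltxx.
  exact: toR_lt.
by apply/negbTE; rewrite -leNgt ltW ?toR_lt.
Qed.

Lemma toR_rat (q : rat) : toR (ratr q) = ratr q.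
Proof.
have qr : (ratr q : algC) \is Num.real by exact: Creal_Crat (Crat_rat q).
by apply/eqP; rewrite eq_le toR_le_rat // toR_ge_rat.
Qed.

Lemma toR_nat (n : nat) : toR n%:R = n%:R.
Proof. by rewrite -(ratr_nat _ n) toR_rat ratr_nat. Qed.

Lemma toR0 : toR 0 = 0.
Proof. exact: toR_nat 0. Qed.

Lemma toR_ge0 (x : algC) : 0 <= x -> 0 <= toR x.
Proof.
by move=> x0; have := @toR_ge_rat x 0 (ger0_real x0); rewrite !rmorph0; apply.
Qed.

Lemma ratr_lt_toR (z : algC) (q : rat) : z \is Num.real ->
  (ratr q < toR z) = (ratr q < z).
Proof.
move=> zr; rewrite -(toR_rat q) ltr_toR //.
exact: Creal_Crat (Crat_rat q).
Qed.

Lemma toR_lt_ratr (z : algC) (q : rat) : z \is Num.real ->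
  (toR z < ratr q) = (z < ratr q).
Proof.
move=> zr; rewrite -(toR_rat q) ltr_toR //.
exact: Creal_Crat (Crat_rat q).
Qed.

(** Together with [rat_factor_gt] this serves the multiplicativity of [toR]: a strict gap between a
    number and a product is witnessed by rational approximations of the two factors. *)
Lemma rat_factor_lt (a b c : R) : 0 <= a -> 0 < b -> 0 < c -> a < b * c ->
  exists p q : rat, [/\ 0 < p, 0 < q, ratr p < b, ratr q < c & a < ratr p * ratr q].
Proof.
move=> a0 b0 c0 abc.
have [p] : exists p : rat, ratr p \in `]a / c, b[%R by apply: rat_in_itvoo; rewrite ltr_pdivrMr.
rewrite in_itv /= => /andP[h1 h2].
have p0 : 0 < ratr p :> R by apply: le_lt_trans h1; rewrite divr_ge0 // ltW.
have [q] : exists q : rat, ratr q \in `]a / ratr p, c[%R.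
  by apply: rat_in_itvoo; rewrite ltr_pdivrMr // mulrC -ltr_pdivrMr.
rewrite in_itv /= => /andP[h3 h4].
have q0 : 0 < ratr q :> R by apply: le_lt_trans h3; rewrite divr_ge0 // ltW.
exists p, q; rewrite -(ltr0q R) p0 -(ltr0q R) q0; split=> //.
by rewrite mulrC -ltr_pdivrMr.
Qed.

Lemma rat_factor_gt (a b c : R) : 0 < b -> 0 < c -> b * c < a ->
  exists p q : rat, [/\ 0 < p, 0 < q, b < ratr p, c < ratr q & ratr p * ratr q < a].
Proof.
move=> b0 c0 abc.
have [p] : exists p : rat, ratr p \in `]b, a / c[%R by apply: rat_in_itvoo; rewrite ltr_pdivlMr.
rewrite in_itv /= => /andP[h1 h2].
have p0 : 0 < ratr p :> R by apply: lt_trans h1.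
have [q] : exists q : rat, ratr q \in `]c, a / ratr p[%R.
  by apply: rat_in_itvoo; rewrite ltr_pdivlMr // mulrC -ltr_pdivlMr.
rewrite in_itv /= => /andP[h3 h4].
have q0 : 0 < ratr q :> R by apply: lt_trans h3.
exists p, q; rewrite -(ltr0q R) p0 -(ltr0q R) q0; split=> //.
by rewrite mulrC -ltr_pdivlMr.
Qed.

Lemma toR_gt0 (x : algC) : 0 < x -> 0 < toR x.
Proof. by move=> x0; rewrite -toR0 ltr_toR ?(gtr0_real x0) // realE lexx. Qed.

(** If the two sides differed, the rationals [p] and [q] separating them would transfer to [algC],
    where multiplying their bounds on [x] and [y] contradicts the bound on [x * y]. *)
Lemma toRM (x y : algC) : 0 <= x -> 0 <= y -> toR (x * y) = toR x * toR y.
Proof.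
rewrite !le_eqVlt => /predU1P[<-|x0]; first by rewrite mul0r toR0 mul0r.
case/predU1P=> [<-|y0]; first by rewrite mulr0 toR0 mulr0.
have [xr yr] := (gtr0_real x0, gtr0_real y0).
have xyr : x * y \is Num.real by rewrite rpredM.
have [X0 Y0] := (toR_gt0 x0, toR_gt0 y0).
case: (ltgtP (toR (x * y)) (toR x * toR y)) => // h; exfalso.
  have [p [q [p0 q0]]] := rat_factor_lt (toR_ge0 (mulr_ge0 (ltW x0) (ltW y0))) X0 Y0 h.
  rewrite !ratr_lt_toR // -rmorphM /= toR_lt_ratr // => px qy pq; have := lt_geF pq.
  by rewrite rmorphM /= ler_pM // ?ler0q ltW.
have [p [q [p0 q0]]] := rat_factor_gt X0 Y0 h.
rewrite !toR_lt_ratr // -rmorphM /= ratr_lt_toR // => px qy pq; have := lt_geF pq.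
by rewrite rmorphM /= ler_pM // ltW.
Qed.

(** * Sublattices of Z^r *)

Section IntegerLattices.

(** Clearing denominators turns a rational relation between the rows into an integral one. *)
Lemma int_row_free (m n : nat) (M : 'M[int]_(m, n)) :
  (forall k : 'rV[int]_m, k *m M = 0 -> k = 0) ->
  row_free (map_mx intr M : 'M[rat]_(m, n)).
Proof.
move=> inj; apply: inj_row_free => v vM.
pose D := \prod_i denq (v 0 i).
have D0 : D%:~R != 0 :> rat by rewrite intr_eq0; apply/prodf_neq0=> i _; rewrite denq_neq0.
pose k : 'rV[int]_m := \row_i (numq (v 0 i) * \prod_(j | j != i) denq (v 0 j)).
have kE : map_mx intr k = D%:~R *: v.
  apply/rowP=> i.
  have -> : D = denq (v 0 i) * \prod_(j | j != i) denq (v 0 j) by rewrite /D (bigD1 i).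
  rewrite !mxE !intrM; set p := (\prod_(j | _) _)%:~R.
  by rewrite -{3}[v 0 i]divq_num_den; field; rewrite intr_eq0 denq_neq0.
have /inj k0 : k *m M = 0.
  have : map_mx intr (k *m M) = 0 :> 'rV[rat]_n.
    by rewrite map_mxM /= kE -scalemxAl vM scaler0.
  by move/rowP=> kM; apply/rowP=> j; have := kM j; rewrite !mxE => /eqP; rewrite intr_eq0 => /eqP.
apply/eqP; have /eqP := kE; rewrite k0 map_mx0 eq_sym scaler_eq0.
by rewrite (negbTE D0).
Qed.

Lemma int_free_leq (m n : nat) (M : 'M[int]_(m, n)) :
  (forall k : 'rV[int]_m, k *m M = 0 -> k = 0) -> (m <= n)%N.
Proof. by move/int_row_free/eqP=> <-; apply: rank_leq_col. Qed.

Lemma int_free_det (n : nat) (M : 'M[int]_n) :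
  (forall k : 'rV[int]_n, k *m M = 0 -> k = 0) -> \det M != 0.
Proof.
move/int_row_free; rewrite row_free_unit unitmxE det_map_mx unitfE.
by rewrite intr_eq0.
Qed.

(** Descent on [|det E|]: while the rows of [E] fail to generate [P], replacing one row by the
    remainder of an uncovered vector gives a smaller nonzero determinant. *)
Lemma sublattice_basis (r : nat) (P : 'rV[int]_r -> Prop) (E0 : 'M[int]_r) :
  (forall x y, P x -> P y -> P (x - y)) ->
  (forall i, P (row i E0)) -> \det E0 != 0 ->
  exists E : 'M[int]_r, [/\ forall i, P (row i E), \det E != 0
    & forall v, P v -> exists k : 'rV[int]_r, v = k *m E].
Proof.
move=> PB; have [n] := ubnP `|\det E0|%N; elim: n E0 => // n IHn E le_n PE E_neq0.
have [full|/boolp.existsNP[c]] :=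
    boolp.pselect (forall v, P v -> exists k : 'rV[int]_r, v = k *m E).
  by exists E.
move/boolp.not_implyP=> [Pc no].
(* By Cramer's rule [c] has coordinates [q / D] on the rows of [E]; [a] collects their integer parts
   and [b] the remainders modulo [D]. *)
pose D := \det E; pose q := c *m \adj E.
pose a : 'rV[int]_r := \row_j divz (q 0 j) D.
pose b : 'rV[int]_r := \row_j modz (q 0 j) D.
have P0 : P 0.
  by rewrite -(subrr c); apply: PB.
have PD x y : P x -> P y -> P (x + y).
  by move=> Px Py; rewrite -[y]opprK; apply: (PB) => //; rewrite -sub0r; apply: (PB).
have PZ (z : int) x : P x -> P (z *: x).
  move=> Px; have Pn m : P (m%:Z *: x).
    elim: m => [|m IHm]; first by rewrite scale0r.
    by rewrite intS scalerDl scale1r; apply: PD.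
  case: z => m //; rewrite NegzE scaleNr -sub0r; exact: PB.
pose c' := c - a *m E.
have Pc' : P c'.
  apply: PB => //; rewrite mulmx_sum_row.
  by apply: (big_ind P) => // i _; apply: PZ.
have c'b : c' *m \adj E = b.
  rewrite mulmxBl -/q -mulmxA mul_mx_adj -/D; apply/rowP=> j.
  rewrite mul_mx_scalar !mxE. by have := divz_eq (q 0 j) D; lia.
have [j bj0] : exists j, b 0 j != 0.
  apply/existsP; rewrite -negb_forall; apply/negP=> /forallP b0.
  have bE : b = 0 by apply/rowP=> j; rewrite [RHS]mxE; apply/eqP.
  apply: no; exists a; apply/eqP; rewrite -subr_eq0 -/c'.
  have /eqP : c' *m \adj E *m E = 0 by rewrite c'b bE mul0mx.
  by rewrite -mulmxA mul_adj_mx mul_mx_scalar scalemx_eq0 (negbTE E_neq0).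
pose E' : 'M[int]_r := \matrix_(i, k) if i == j then c' 0 k else E i k.
(* The cofactors along row [j] are those of [E], so the expansion is the [j]-th entry of
   [c' *m \adj E]. *)
have detE' : \det E' = b 0 j.
  rewrite (expand_det_row _ j) -c'b mxE; apply: eq_bigr => k _.
  rewrite !mxE eqxx; congr (_ * _); rewrite /cofactor; congr (_ * \det _).
  by apply/matrixP=> x y; rewrite !mxE eq_sym (negbTE (neq_lift _ _)).
have lt_n : (`|\det E'| < n)%N.
  have := ltz_mod (q 0 j) E_neq0; have := modz_ge0 (q 0 j) E_neq0.
  have -> : \det E' = modz (q 0 j) D by rewrite detE' [LHS]mxE.
  by move: le_n; rewrite -/D; lia.
apply: (IHn E' lt_n); rewrite ?detE' // => i.
have [->|ij] := eqVneq i j.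
  suff -> : row j E' = c' by [].
  by apply/rowP=> k; rewrite !mxE eqxx.
suff -> : row i E' = row i E by [].
by apply/rowP=> k; rewrite !mxE (negbTE ij).
Qed.

Lemma int_unit_det (n : nat) (M : 'M[int]_n) : M \in unitmx -> `|\det M|%N = 1%N.
Proof. by rewrite unitmxE => /orP[] /eqP ->. Qed.

(** By the Smith normal form the lattice becomes, after unimodular changes of basis, a product of
    one-dimensional lattices with generators [d_i]. Vectors of residues are representatives, and
    their number is the product of the [|d_i|]. *)
Lemma int_cosets_cover (r : nat) (M : 'M[int]_r) : \det M != 0 ->
  exists reps : 'I_(`|\det M|) -> 'rV[int]_r,
    forall v, exists i, exists k : 'rV[int]_r, v = reps i + k *m M.
Proof.
have [L Lu [Q Qu [d _ ->]]] := int_Smith_normal_form M.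
pose w : 'rV[int]_r := \row_i d`_i.
have -> : \matrix_(i < r, j < r) (d`_i *+ (i == j :> nat)) = diag_mx w.
  by apply/matrixP=> i j; rewrite !mxE.
rewrite !det_mulmx det_diag => neq0.
have w0 (i : 'I_r) : d`_i != 0.
  apply: contraNneq neq0 => wi; rewrite (bigD1 i) //= mxE wi mul0r mulr0 mul0r //.
have -> : `|(\det L * \prod_i w 0 i * \det Q)%R|%N = #|{dffun forall i : 'I_r, 'I_`|d`_i|}|.
  rewrite !abszM !int_unit_det // mul1n muln1 card_dep_ffun.
  rewrite (big_morph absz abszM (erefl : `|1%R|%N = 1%N)) foldrE big_map big_enum.
  by apply: eq_bigr => i _; rewrite mxE card_ord.
pose rep (f : {dffun forall i : 'I_r, 'I_`|d`_i|}) : 'rV[int]_r :=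
  (\row_i (f i)%:Z) *m Q.
exists (fun i => rep (enum_val i)) => v.
pose x := v *m invmx Q.
have modlt (i : 'I_r) : (absz (modz (x 0%R i) (w 0%R i)) < absz (nth 0%R d i))%N.
  have := ltz_mod (x 0 i) (w0 i); have := modz_ge0 (x 0 i) (w0 i).
  rewrite (_ : w 0 i = d`_i) ?[LHS]mxE //; lia.
pose f : {dffun forall i : 'I_r, 'I_`|d`_i|} := [ffun i => Ordinal (modlt i)].
exists (enum_rank f), ((\row_i divz (x 0 i) d`_i) *m invmx L).
rewrite enum_rankK !mulmxA mulmxKV // -mulmxDl -[LHS](mulmxKV Qu) -/x; congr (_ *m _).
apply/rowP=> i; rewrite mul_mx_diag !mxE ffunE /= addrC [LHS](divz_eq _ d`_i).
by rewrite (_ : w 0 i = d`_i) ?[LHS]mxE // gez0_abs ?modz_ge0 // [x 0 i]mxE.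
Qed.

End IntegerLattices.

(** * Algebraic integers *)

Section AlgebraicIntegers.
Variable L : fieldExtType rat.
Implicit Types (x y : L).

Lemma is_alg_intP x : is_alg_int x <-> integralOver (intr : int -> L) x.
Proof. by split=> [[p []] | [p]]; exists p. Qed.

Lemma alg_intB x y : is_alg_int x -> is_alg_int y -> is_alg_int (x - y).
Proof. by rewrite !is_alg_intP; apply: integral_sub. Qed.

Lemma alg_intD x y : is_alg_int x -> is_alg_int y -> is_alg_int (x + y).
Proof. by rewrite !is_alg_intP; apply: integral_add. Qed.

Lemma alg_intM x y : is_alg_int x -> is_alg_int y -> is_alg_int (x * y).
Proof. by rewrite !is_alg_intP; apply: integral_mul. Qed.

Lemma alg_int_int (z : int) : is_alg_int (z%:~R : L).
Proof. by rewrite is_alg_intP; apply: integral_id. Qed.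

Lemma alg_int1 : is_alg_int (1 : L).
Proof. exact: (alg_int_int 1). Qed.

Lemma alg_int_sum (I : finType) (P : pred I) (F : I -> L) :
  (forall i, is_alg_int (F i)) -> is_alg_int (\sum_(i | P i) F i).
Proof.
move=> FP; apply: (big_ind (@is_alg_int L)) => //; last exact: alg_intD.
exact: (alg_int_int 0).
Qed.

Lemma alg_int_prod (I : finType) (P : pred I) (F : I -> L) :
  (forall i, is_alg_int (F i)) -> is_alg_int (\prod_(i | P i) F i).
Proof.
by move=> FP; apply: (big_ind (@is_alg_int L)) => //; [exact: alg_int1 | exact: alg_intM].
Qed.

Lemma alg_int_rmorph (K : fieldExtType rat) (f : {rmorphism L -> K}) x :
  is_alg_int x -> is_alg_int (f x).
Proof.
case=> p [mp px]; exists p; split=> //.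
rewrite (_ : map_poly _ p = map_poly f (map_poly intr p)) ?rmorph_root //.
by rewrite -map_poly_comp; apply: eq_map_poly => z; rewrite /= rmorph_int.
Qed.

Lemma alg_int_Aint (f : {rmorphism L -> algC}) x : is_alg_int x -> f x \in Aint.
Proof.
case=> p [mp px].
have := rmorph_root f px; rewrite -map_poly_comp (eq_map_poly (g := intr)); last first.
  by move=> z; rewrite /= rmorph_int.
move/root_monic_Aint; apply; first exact: monic_map.
by apply/polyOverP=> i; rewrite coef_map /= intr_int.
Qed.

(* If [q] has leading coefficient [a] and root [x], then [a x] is a root of
   the monic polynomial [a^(n-1) q(X/a)]. *)
Lemma alg_int_multiple (f : {rmorphism L -> algC}) x :
  exists n : int, n != 0 /\ is_alg_int (n%:~R * x).
Proof.
have [p mp px] := algC_algebraic (f x).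
have [q [a a0 pq]] := rat_poly_scale p.
have px' : root (map_poly (intr : int -> L) q) x.
  rewrite -(fmorph_root f) -map_poly_comp (eq_map_poly (g := intr)); last first.
    by move=> z; rewrite /= rmorph_int.
  move: px; rewrite pq map_polyZ /= rootZ ?fmorph_eq0 ?invr_eq0 ?intr_eq0 //.
  rewrite -map_poly_comp (eq_map_poly (g := intr)) // => z.
  by rewrite /= ratr_int.
have q0 : q != 0.
  apply: contraTneq mp => q0; rewrite pq q0 map_poly0 scaler0.
  by apply/negP=> /monic_neq0; rewrite eqxx.
pose b := lead_coef q; have b0 : b != 0 by rewrite lead_coef_eq0.
exists b; split=> //.
have [n sz] : exists n, size q = n.+1 by exists (size q).-1; rewrite prednK // lt0n size_poly_eq0.
have n0 : (0 < n)%N.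
  case: n sz => // sz; have /size_poly1P[c c0 qc] : size q == 1%N by rewrite sz.
  by move: px'; rewrite qc map_polyC /= rootC -(fmorph_eq0 f) rmorph_int intr_eq0 (negbTE c0).
pose p' : {poly int} := \poly_(i < n) (q`_i * b ^+ (n.-1 - i)) + 'X^n.
exists p'; split.
  rewrite monicE lead_coefDr ?lead_coefXn // size_polyXn ltnS.
  exact: size_poly.
have := px'; rewrite /root => /eqP q_x; apply/eqP.
have -> : (map_poly (intr : int -> L) p').[b%:~R * x] =
    b%:~R ^+ n.-1 * (map_poly (intr : int -> L) q).[x].
  rewrite /p' rmorphD /= map_polyXn hornerD hornerXn.
  rewrite (@horner_coef_wide _ n.+1 (map_poly _ q)); last first.
    by rewrite (leq_trans (size_poly _ _)) ?sz.
  rewrite (@horner_coef_wide _ n); last first.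
    by rewrite (leq_trans (size_poly _ _)) // size_poly.
  rewrite big_ord_recr /= mulrDr mulr_sumr; congr (_ + _).
    apply: eq_bigr => i _; rewrite !coef_map coef_poly ltn_ord /= rmorphM rmorphXn /=.
    have -> : b%:~R ^+ n.-1 = b%:~R ^+ (n.-1 - i) * b%:~R ^+ i :> L.
      by rewrite -exprD subnK // -ltnS prednK.
    by rewrite exprMn; ring.
  rewrite coef_map /= (_ : q`_n = b); last by rewrite /b lead_coefE sz.
  by rewrite exprMn mulrA -exprSr prednK.
by rewrite q_x mulr0.
Qed.

End AlgebraicIntegers.

(** * Embeddings and the Galois group *)

Section GaloisEmbeddings.
Variables (L : splittingFieldType rat) (iota : {rmorphism L -> algC}).
Notation G := (GalQ L).
Implicit Types (s t : G) (x y : L).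

Lemma galME s t x : (s * t)%g x = t (s x).
Proof. exact: galM (memvf x). Qed.

Lemma galKV s x : s (s^-1%g x) = x.
Proof. by rewrite -galME mulVg gal_id. Qed.

Lemma prod_galM (T : Type) (idx : T) (op : Monoid.com_law idx) (F : G -> T) s :
  \big[op/idx]_(t : G) F t = \big[op/idx]_(t : G) F (t * s)%g.
Proof. exact: (reindex_inj (mulIg s)). Qed.

Lemma pchar_L : [pchar L] =i pred0.
Proof. by move=> p; rewrite -[RHS](pchar_num algC p) (fmorph_pchar iota). Qed.

Lemma galois_Q : galois 1 {:L}.
Proof.
rewrite /galois sub1v normalFieldf andbT /=; apply/separableP => x _.
exact: pcharf0_separable pchar_L x.
Qed.

Lemma galQ_full : 'Gal({:L} / 1)%g = [set: G].
Proof.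
apply/setP=> s; by rewrite inE gal_kHom ?sub1v // k1AHom.
Qed.

Lemma card_galQ : #|{: G}| = \dim {:L}.
Proof. by rewrite -cardsT -galQ_full -(galois_dim galois_Q) dimv1 divn1. Qed.

Lemma gal_fixed_rat x : (forall s, s x = x) -> exists q : rat, x = q%:A.
Proof.
move=> fix_x; have : x \in fixedField 'Gal({:L} / 1)%g.
  by apply/fixedFieldP=> [|s _]; rewrite ?memvf.
rewrite (galois_fixedField galois_Q) => /vlineP[q ->]; by exists q.
Qed.

Lemma rmorph_in_alg (t : {rmorphism L -> algC}) (q : rat) : t q%:A = ratr q.
Proof. exact: (fmorph_eq_rat (t \o in_alg L)). Qed.

(** The characteristic polynomial of [x] over the rationals. *)
Definition gal_poly x : {poly L} := \prod_(s : G) ('X - (s x)%:P).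

Lemma gal_poly_rat x : exists p : {poly rat}, gal_poly x = map_poly (in_alg L) p.
Proof.
have /boolp.choice[f fE] : forall i, exists q : rat, (gal_poly x)`_i = q%:A.
  move=> i; apply: gal_fixed_rat => s; rewrite -coef_map.
  suff -> : map_poly s (gal_poly x) = gal_poly x by [].
  rewrite /gal_poly rmorph_prod /= (prod_galM _ _ s^-1%g) /=.
  by apply: eq_bigr => t _; rewrite rmorphB /= map_polyX map_polyC /= galME galKV.
exists (\poly_(i < size (gal_poly x)) f i); apply/polyP=> i.
rewrite coef_map coef_poly; case: ltnP => [_|h]; first exact: fE.
by rewrite /= scale0r nth_default.
Qed.

(** A primitive element [th] determines [t]. Since [gal_poly th] has rational coefficients, [t] and
    [iota] send it to the same polynomial, so [t th] is one of the roots [iota (s th)]. *)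
Lemma emb_gal (t : {rmorphism L -> algC}) : exists s : G, forall x, t x = iota (s x).
Proof.
have sep : separable 1 {:L} by case/and3P: galois_Q.
have genL := eq_adjoin_separable_generator sep (sub1v _).
set th := separable_generator _ _ in genL.
have [p gp] := gal_poly_rat th.
have : root (map_poly t (gal_poly th)) (t th).
  rewrite fmorph_root /gal_poly (bigD1 1%g) //= gal_id rootM root_XsubC eqxx //.
have -> : map_poly t (gal_poly th) = map_poly iota (gal_poly th).
  by rewrite gp -!map_poly_comp; apply: eq_map_poly => q; rewrite /= !rmorph_in_alg.
rewrite /gal_poly rmorph_prod /root horner_prod prodf_seq_eq0 => /hasP[s _ /=].
rewrite rmorphB /= map_polyX map_polyC /= hornerXsubC subr_eq0 => /eqP ts.
exists s => x; have : x \in <<1; th>>%VS by rewrite -genL memvf.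
case/Fadjoin_polyP=> q q1 ->; rewrite -!horner_map /= ts; congr (_.[_]).
rewrite -map_poly_comp; apply/polyP=> i; rewrite !coef_map /=.
have /polyOverP/(_ i)/vlineP[a ->] := q1.
by rewrite rmorph_in_alg -(rmorph_in_alg (iota \o s)).
Qed.

Lemma complex_conj_gal : exists c : G, forall x, iota (c x) = (iota x)^*.
Proof.
by have [c cE] := emb_gal (Num.conj_op \o iota); exists c => x; rewrite -cE.
Qed.

Lemma gal_ext s t : (forall x, s x = t x) -> s = t.
Proof. by move=> st; apply/eqP/gal_eqP => x _; apply: st. Qed.

(** The norm is fixed by the Galois group, hence rational; being also an algebraic integer, it is an
    integer. *)
Lemma norm_int x : is_alg_int x -> exists z : int, \prod_(s : G) s x = z%:~R.
Proof.
move=> xint.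
have [q Nq] : exists q : rat, \prod_(s : G) s x = q%:A.
  apply: gal_fixed_rat => t; rewrite rmorph_prod (prod_galM _ _ t^-1%g) /=.
  by apply: eq_bigr => s _; rewrite galME galKV.
have : iota (\prod_(s : G) s x) \in Num.int.
  apply: Cint_rat_Aint; first by rewrite Nq rmorph_in_alg Crat_rat.
  by apply: alg_int_Aint; apply: alg_int_prod => s; apply: alg_int_rmorph.
case/intrP=> z Nz; exists z; apply: (fmorph_inj iota).
by rewrite Nz rmorph_int.
Qed.

Lemma norm_ge1 x : is_alg_int x -> x != 0 -> 1 <= \prod_(s : G) `|iota (s x)|.
Proof.
move=> xint x0; have [z Nz] := norm_int xint.
rewrite -normr_prod -rmorph_prod Nz rmorph_int -intr_norm -[1]/(1%:~R) ler_int.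
suff : z != 0 by lia.
rewrite -(intr_eq0 algC) -(rmorph_int iota) -Nz fmorph_eq0 prodf_seq_neq0.
by apply/allP=> s _; rewrite fmorph_eq0.
Qed.

Lemma unit_norm1 x : is_OK_unit x -> \prod_(s : G) `|iota (s x)| = 1.
Proof.
case=> xint [x0 xVint]; apply/eqP; rewrite eq_le norm_ge1 // andbT.
have := norm_ge1 xVint; rewrite invr_eq0 => /(_ x0).
under eq_bigr do rewrite !fmorphV normfV.
rewrite prodfV invf_ge1 //; apply: prodr_gt0 => s _.
by rewrite normr_gt0 !fmorph_eq0.
Qed.

End GaloisEmbeddings.

(** * Existence of a contracting unit *)

Section DirichletUnit.
Variables (L : splittingFieldType rat) (iota : {rmorphism L -> algC}).
Notation G := (GalQ L).
Notation d := (\dim {:L}).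
Variable c : G.
Hypothesis cE : forall x, iota (c x) = (iota x)^*.
Implicit Types (s t : G) (x y : L).
(** The decomposition group of the place of [iota]. It has one element when [c = 1] and two
    otherwise, so [#|H|] is the local degree, common to all archimedean places. *)
Let H : {set G} := [set 1%g; c].

Lemma conj_galK : (c * c)%g = 1%g.
Proof.
apply: gal_ext => x; apply: (fmorph_inj iota).
by rewrite galME gal_id !cE conjCK.
Qed.

Lemma norm_mul_conj s x : `|iota ((s * c)%g x)| = `|iota (s x)|.
Proof. by rewrite galME cE norm_conjC. Qed.

Lemma mulc_notin s : s \notin H -> (s * c)%g \notin H.
Proof.
have e : s = (s * c * c)%g by rewrite -mulgA conj_galK mulg1.
rewrite !inE; apply: contraNN => /orP[] /eqP sc; rewrite e sc.
  by rewrite mul1g eqxx orbT.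
by rewrite conj_galK eqxx.
Qed.

(** A real form for each embedding: at a real place it is the embedding itself, and at a complex
    place [s] and [s * c] give [Re + Im] and [Re - Im]. Real and complex fields are thus treated
    alike. *)
Definition re_im s x : algC := 'Re (iota (s x)) + 'Im (iota (s x)).

Lemma re_im_real s x : re_im s x \is Num.real.
Proof. by rewrite rpredD ?Creal_Re ?Creal_Im. Qed.

Lemma re_imB s x y : re_im s (x - y) = re_im s x - re_im s y.
Proof. by rewrite /re_im !rmorphB !raddfB /=; ring. Qed.

Lemma re_im_sum s (I : finType) (F : I -> L) :
  re_im s (\sum_i F i) = \sum_i re_im s (F i).
Proof. by rewrite /re_im !rmorph_sum !raddf_sum -big_split. Qed.

Lemma re_im_int s (z : int) x : re_im s (z%:~R * x) = z%:~R * re_im s x.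
Proof.
rewrite /re_im !rmorphM !rmorph_int /= ReMl ?ImMl ?mulrDr //; exact: realz.
Qed.

(* The two forms at [s] and [s c] together control [iota (s x)], whether the
   place is real or complex. *)
Lemma norm_le_re_im s x b :
  `|re_im s x| <= b -> `|re_im (s * c)%g x| <= b -> `|iota (s x)| <= b.
Proof.
move=> h1 h2; have b0 : 0 <= b := le_trans (normr_ge0 _) h1.
rewrite -(@ler_pXn2r _ 2) ?nnegrE // normC2_Re_Im.
have -> : 'Re (iota (s x)) ^+ 2 + 'Im (iota (s x)) ^+ 2 =
          (re_im s x ^+ 2 + re_im (s * c)%g x ^+ 2) / 2.
  by rewrite /re_im galME cE Re_conj Im_conj; field.
rewrite ler_pdivrMr // [b ^+ 2 * 2]mulr_natr mulr2n.
by apply: lerD; rewrite -real_normK ?re_im_real // ler_pXn2r ?nnegrE.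
Qed.

(** A vector space basis with each member scaled by an integer to become integral. It spans a
    lattice of full rank, possibly smaller than the ring of integers. *)
Lemma integral_basis : exists b : 'I_d -> L, (forall i, is_alg_int (b i)) /\
  (forall a : 'I_d -> int, \sum_i (a i)%:~R * b i = 0 -> forall i, a i = 0).
Proof.
pose v := vbasis {:L}.
have /boolp.choice[n nP] : forall i : 'I_d, exists n : int, n != 0 /\ is_alg_int (n%:~R * v`_i).
  by move=> i; apply: (alg_int_multiple iota).
exists (fun i => (n i)%:~R * v`_i); split=> [i|a a0 i]; first by case: (nP i).
have fr : free v := basis_free (vbasisP _).
have /freeP/(_ (fun i => (a i * n i)%:~R)) := fr.
have -> : \sum_(j < d) (a j * n j)%:~R *: v`_j = 0.
  rewrite -[RHS]a0; apply: eq_bigr => j _; rewrite mulrA -intrM.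
  by rewrite scaler_int mulrzl.
move=> /(_ erefl)/(_ i)/eqP; rewrite intr_eq0 mulf_eq0 => /orP[/eqP //|].
by case: (nP i) => /negbTE ->.
Qed.

Section SmallElements.
Variable b : 'I_d -> L.
Hypothesis b_int : forall i, is_alg_int (b i).
Hypothesis b_free :
  forall a : 'I_d -> int, \sum_i (a i)%:~R * b i = 0 -> forall i, a i = 0.

Definition int_comb (a : 'I_d -> int) : L := \sum_i (a i)%:~R * b i.

Lemma int_comb_alg_int a : is_alg_int (int_comb a).
Proof. by apply: alg_int_sum => i; apply: alg_intM => //; apply: alg_int_int. Qed.

Lemma re_im_int_comb : exists C : nat, forall (T : nat) (a : 'I_d -> int) s, (0 < T)%N ->
  (forall i, (`|a i| <= T)%N) -> `|re_im s (int_comb a)| < C%:R * T%:R.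
Proof.
have [C hC] : exists C : nat, \sum_i \sum_s `|re_im s (b i)| < C%:R :> algC.
  by apply: algC_real_archi; apply: ger0_real; do 2!apply: sumr_ge0 => ? _.
exists C => T a s T0 aT; apply: le_lt_trans (_ : T%:R * (\sum_i \sum_s `|re_im s (b i)|) < _); last first.
  by rewrite mulrC ltr_pM2r // ltr0n.
rewrite /int_comb re_im_sum mulr_sumr; apply: le_trans (ler_norm_sum _ _ _) _.
apply: ler_sum => i _; rewrite re_im_int normrM; apply: ler_pM => //.
  by rewrite -intr_norm -[T%:R]/(T%:Z%:~R) ler_int; have := aT i; lia.
by rewrite (bigD1 s) //= lerDl sumr_ge0.
Qed.

(** Dirichlet's box principle: two integral combinations fall in the same box for all forms outside
    [H], and their difference is small there. Inside [H] it is at most [C T], which keeps the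
    product bounded independently of [K]. *)
Lemma small_elements : exists C B : nat, forall K : nat, (0 < K)%N ->
  exists a : 'I_d -> int, [/\ int_comb a != 0,
    forall s, s \notin H -> `|iota (s (int_comb a))| <= C%:R / K%:R
    & \prod_(s : G) `|iota (s (int_comb a))| <= B%:R].
Proof.
have [C hC] := re_im_int_comb.
pose m := #|~: H|; pose d0 := #|H|.
have dE : (d0 + m)%N = d by rewrite cardsC -(card_galQ iota).
have d0_gt0 : (0 < d0)%N by apply/card_gt0P; exists 1%g; rewrite !inE eqxx.
exists (2 * C)%N, ((2 * C) ^ m * C ^ d0)%N => K K0.
have KR : 0 < K%:R :> algC by rewrite ltr0n.
(* With this [T] there are [(T + 1)^d] coefficient vectors against only [(K^d)^m = T^d] boxes. *)
pose T := (K ^ m)%N; have T0 : (0 < T)%N by rewrite expn_gt0 K0.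
have C0 : 0 < C%:R :> algC.
  have := hC T (fun=> 0) 1%g T0 (fun=> leq0n _).
  by move/(le_lt_trans (normr_ge0 _)); rewrite pmulr_lgt0 // ltr0n.
pose vec (v : {ffun 'I_d -> 'I_T.+1}) : 'I_d -> int := fun i => (v i)%:Z.
(* An affine rescaling of the form, of size below [C T], into [[0, K^d)]; boxes of length 1
   correspond to length [2C / K^d0]. *)
pose z v s : algC := re_im s (int_comb (vec v)) * K%:R ^+ d0 / (2 * C%:R) + (K ^ d)%:R / 2.
have z_itv v s : 0 <= z v s < (K ^ d)%:R.
  have : `|re_im s (int_comb (vec v)) * K%:R ^+ d0 / (2 * C%:R)| < (K ^ d)%:R / 2.
    rewrite !normrM normfV [`|K%:R ^+ d0|]ger0_norm ?exprn_ge0 // [`|2 * _|]gtr0_norm ?mulr_gt0 //.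
    rewrite ltr_pdivrMr ?mulr_gt0 // -dE expnD natrM !natrX.
    have cancel2 (p q w : algC) : p * q / 2 * (2 * w) = w * q * p by field.
    rewrite cancel2 -(natrX _ K m) -/T.
    rewrite ltr_pM2r ?exprn_gt0 //; apply: hC => // i.
    by rewrite /vec absz_nat -ltnS.
  rewrite real_ltr_norml; last first.
    by rewrite !rpredM ?rpredV ?re_im_real ?rpredX ?rpredM ?realn.
  case/andP=> h1 h2; rewrite /z -lerBlDr sub0r ltW //=.
  by rewrite [ltRHS](splitr (K ^ d)%:R) ltrD2r.
have z_lt v s : (Num.truncn (z v s) < K ^ d)%N.
  rewrite -(ltr_nat algC); case/andP: (z_itv v s) => h1 h2.
  by apply: le_lt_trans h2; case/andP: (truncn_itv h1).
pose f v : {ffun {s : G | s \in ~: H} -> 'I_(K ^ d)} := [ffun s => Ordinal (z_lt v (val s))].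
have : ~~ injectiveb f.
  apply/negP=> /injectiveP/leq_card; rewrite !card_ffun !card_ord card_sig.
  have -> : #|[pred s | s \in ~: H]| = m by apply: eq_card.
  have dim_gt0 : (0 < d)%N by rewrite -dE addn_gt0 d0_gt0.
  by rewrite -expnM [(d * m)%N]mulnC expnM leqNgt ltn_exp2r // ltnS leqnn.
case/injectivePn=> v [v' vv' fvv'].
pose a i := vec v i - vec v' i.
have combB : int_comb a = int_comb (vec v) - int_comb (vec v').
  by rewrite /int_comb -sumrB; apply: eq_bigr => i _; rewrite intrB mulrBl.
have y_small s : s \notin H -> `|re_im s (int_comb a)| <= (2 * C)%:R / K%:R ^+ d0.
  move=> sH; have sH' : s \in ~: H by rewrite inE.
  have : Num.truncn (z v s) = Num.truncn (z v' s).
    by have /ffunP/(_ (exist _ s sH')) := fvv'; rewrite !ffunE => /(congr1 val).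
  case/andP: (z_itv v s) => /truncn_itv/andP[h1 h2] _.
  case/andP: (z_itv v' s) => /truncn_itv/andP[h3 h4] _ tt.
  have : `|z v s - z v' s| < 1.
    rewrite real_ltr_norml ?rpredB ?ger0_real ?(le_trans (ler0n _ _) h1) ?(le_trans (ler0n _ _) h3) //.
    apply/andP; split.
      rewrite ltrBrDr addrC ltrBlDr; apply: lt_le_trans h4 _.
      by rewrite -tt -natr1 lerD2r.
    rewrite ltrBlDr; apply: lt_le_trans h2 _.
    by rewrite tt -nat1r lerD2l.
  have -> : z v s - z v' s = re_im s (int_comb a) * (K%:R ^+ d0 / (2 * C%:R)).
    have factor (p q v1 v2 w : algC) : p * w / q + v1 - (v2 * w / q + v1) = (p - v2) * (w / q).
      by rewrite opprD addrACA subrr addr0 -!mulrA -mulrBl.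
    by rewrite /z combB re_imB factor.
  rewrite normrM [`|_ / _|]gtr0_norm ?divr_gt0 ?mulr_gt0 ?exprn_gt0 // => lt1.
  apply: ltW; rewrite natrM -invf_div -[ltRHS]div1r ltr_pdivlMr //.
  by rewrite divr_gt0 ?mulr_gt0 ?exprn_gt0.
have av_small s : s \notin H -> `|iota (s (int_comb a))| <= (2 * C)%:R / K%:R ^+ d0.
  by move=> sH; apply: norm_le_re_im; apply: y_small => //; apply: mulc_notin.
have av_big s : `|iota (s (int_comb a))| <= C%:R * T%:R.
  have hb t : `|re_im t (int_comb a)| <= C%:R * T%:R.
    apply/ltW/hC => // i; rewrite /a /vec.
    by move: (ltn_ord (v i)) (ltn_ord (v' i)); rewrite !ltnS /T; move: (nat_of_ord _) (nat_of_ord _) => p q; move: (K ^ m)%N => n; clear; lia.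
  exact: norm_le_re_im.
exists a; split.
- apply/negP=> /eqP/b_free a0; case/negP: vv'; apply/eqP/ffunP => i; apply/val_inj.
  by have := a0 i; rewrite /a /vec /=; lia.
- move=> s sH; apply: le_trans (av_small s sH) _.
  rewrite ler_wpM2l ?ler0n // lef_pV2 ?posrE ?exprn_gt0 //.
  by rewrite ler_eXnr // ler1n.
rewrite (bigID (mem H)) /=.
have h1 : \prod_(s in H) `|iota (s (int_comb a))| <= (C%:R * T%:R) ^+ d0.
  rewrite -prodr_const; apply: ler_prod => s _; rewrite normr_ge0 /=; exact: av_big.
have h2 : \prod_(s | s \notin H) `|iota (s (int_comb a))| <= ((2 * C)%:R / K%:R ^+ d0) ^+ m.
  rewrite -prodr_const (eq_bigl (fun s => s \in ~: H)) => [|s]; last by rewrite !inE.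
  apply: ler_prod => s; rewrite inE => sH.
  by rewrite normr_ge0 av_small.
(* In [(C K^m)^d0 (2C / K^d0)^m] the powers of [K] cancel. *)
apply: le_trans (ler_pM _ _ h1 h2) _; try exact: prodr_ge0.
have -> : ((2 * C) ^ m * C ^ d0)%:R = (2 * C)%:R ^+ m * C%:R ^+ d0 :> algC.
  by rewrite [LHS]natrM !natrX.
rewrite exprMn [(_ / _) ^+ m]exprMn exprVn -exprM /T (natrX _ K m) -exprM.
rewrite le_eqVlt; apply/orP; left; apply/eqP.
rewrite [(m * d0)%N]mulnC.
have cancelK (p q w : algC) : w != 0 -> p * w^-1 * (q * w) = q * p by move=> w0; field.
by rewrite [in LHS]mulrC cancelK ?expf_neq0 ?gt_eqF // mulrC.
Qed.

End SmallElements.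
End DirichletUnit.

Section DirichletUnitExists.
Variables (L : splittingFieldType rat) (iota : {rmorphism L -> algC}).
Notation G := (GalQ L).
Notation d := (\dim {:L}).

(** The norm of [x] is a nonzero integer of size at most [B], so it divides the factorial of [B],
    and the norm divided by [x] is the product of the other conjugates. *)
Lemma alg_int_fact_div (B : nat) (x : L) : is_alg_int x -> x != 0 ->
  \prod_(s : G) `|iota (s x)| <= B%:R -> is_alg_int (B`!%:R / x).
Proof.
move=> xint x0 hB; have [z Nz] := norm_int iota xint.
have zB : (`|z| <= B)%N.
  rewrite -(ler_nat algC); suff -> : (absz z)%:R = \prod_(s : G) `|iota (s x)| by [].
  by rewrite -normr_prod -rmorph_prod Nz rmorph_int -intr_norm -abszE.
have z0 : z != 0.
  have := norm_ge1 iota xint x0; rewrite -normr_prod -rmorph_prod Nz rmorph_int.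
  by apply: contraTneq => ->; rewrite normr0 ler10.
have [k kE] : exists k : int, B`! = k * z :> int.
  have : (z %| B`!%:Z)%Z by rewrite dvdzE absz_nat dvdn_fact // absz_gt0 z0.
  by case/dvdzP=> k ->; exists k.
have -> : B`!%:R / x = k%:~R * \prod_(s : G | s != 1%g) s x.
  rewrite -[B`!%:R]/(B`!%:Z%:~R) kE intrM -Nz (bigD1 1%g) //= gal_id.
  by field.
apply: alg_intM; first exact: alg_int_int.
by apply: alg_int_prod => s; apply: alg_int_rmorph.
Qed.

(** A sequence of integers [x n] of bounded norm is built with absolute values strictly decreasing
    outside [{1, c}]. Two terms agree modulo [D], which is a multiple of each of them; their
    quotient is a unit. *)
Lemma contracting_unit (c : G) : (forall x, iota (c x) = (iota x)^*) ->
  exists u : L, is_OK_unit u /\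
    forall s, s \notin [set 1%g; c] -> `|iota (s u)| < 1.
Proof.
move=> cE; have [b [b_int b_free]] := integral_basis iota.
have [C [B small]] := small_elements cE b_free.
pose D := B`!; have D0 : (0 < D)%N := fact_gt0 B.
pose good a := int_comb b a != 0 /\ \prod_(s : G) `|iota (s (int_comb b a))| <= B%:R.
pose T := {a : 'I_d -> int | good a}.
pose smaller (a a' : T) := forall s, s \notin [set 1%g; c] ->
  `|iota (s (int_comb b (sval a')))| < `|iota (s (int_comb b (sval a)))|.
have next (a : T) : exists a' : T, smaller a a'.
  case: a => a [x0 aB]; pose x := int_comb b a.
  have pos (s : G) : 0 < `|iota (s x)| by rewrite normr_gt0 !fmorph_eq0.
  (* This [K] makes [C / K] smaller than every [|iota (s x)|]. *)
  have [K hK] : exists K : nat, C%:R * \sum_(s : G) `|iota (s x)|^-1 < K%:R :> algC.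
    apply: algC_real_archi; apply: ger0_real; rewrite mulr_ge0 // sumr_ge0 // => s _.
    by rewrite invr_ge0.
  have K0 : 0 < K%:R :> algC.
    apply: le_lt_trans hK; rewrite mulr_ge0 // sumr_ge0 // => s _.
    by rewrite invr_ge0.
  have [|a' [x'0 x's x'B]] := small K; first by rewrite ltr0n in K0.
  exists (exist _ a' (conj x'0 x'B)) => s sH /=.
  apply: le_lt_trans (x's s sH) _; rewrite ltr_pdivrMr // mulrC -ltr_pdivrMr //.
  apply: le_lt_trans hK; rewrite ler_wpM2l // (bigD1 s) //= lerDl sumr_ge0 // => t _.
  by rewrite invr_ge0.
have [g gP] := boolp.choice next.
have [a0 [x0 _ aB]] := small 1%N isT.
pose a n : T := iter n g (exist _ a0 (conj x0 aB)).
pose x n := int_comb b (sval (a n)).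
have x_int n : is_alg_int (x n) by apply: int_comb_alg_int.
have x_neq0 n : x n != 0 by case: (svalP (a n)).
have x_norm n : \prod_(s : G) `|iota (s (x n))| <= B%:R by case: (svalP (a n)).
have decr i j s : s \notin [set 1%g; c] -> (i < j)%N ->
    `|iota (s (x j))| < `|iota (s (x i))|.
  move=> sH; elim: j => // j IHj; rewrite ltnS leq_eqVlt => /predU1P[->|/IHj].
    exact: gP.
  by apply: lt_trans; apply: gP.
(* The coordinates of [x n] modulo [D]. A residue is below [D], so the default value of [insubd] is
   never returned. *)
pose cls n : {ffun 'I_d -> 'I_D} :=
  [ffun i => insubd (Ordinal D0) `|modz (sval (a n) i) D|%N].
have cls_val n i : (cls n i)%:Z = modz (sval (a n) i) D.
  have D0' : D%:Z != 0 by rewrite -lt0n.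
  have := ltz_mod (sval (a n) i) D0'; have := modz_ge0 (sval (a n) i) D0'.
  rewrite ffunE val_insubd => h1 h2; rewrite ifT; first by lia.
  by have := h1; have := h2; lia.
have : ~~ injectiveb (fun n : 'I_(#|{ffun 'I_d -> 'I_D}|.+1) => cls n).
  by apply/negP=> /injectiveP/leq_card; rewrite card_ord ltnn.
case/injectivePn=> i0 [j0 ij0 fij0].
have {ij0 fij0} [i [j [ij fij]]] : exists i j : nat, (i < j)%N /\ cls i = cls j.
  case: (ltngtP i0 j0) => h; [by exists i0, j0 | by exists j0, i0 |].
  by case/negP: ij0; apply/eqP/val_inj.
have [z zint xij] : exists2 z, is_alg_int z & x j = x i + D%:R * z.
  exists (int_comb b (fun k => divz (sval (a j) k) D - divz (sval (a i) k) D)).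
    exact: int_comb_alg_int.
  rewrite /x /int_comb mulr_sumr -big_split; apply: eq_bigr => k _ /=.
  rewrite mulrA -mulrDl; congr (_ * _).
  rewrite -[D%:R]/(D%:Z%:~R) -intrM -intrD; congr (_%:~R).
  have := divz_eq (sval (a j) k) D; have := divz_eq (sval (a i) k) D.
  rewrite -!cls_val fij; lia.
have Dx n : is_alg_int (D%:R / x n) by apply: alg_int_fact_div.
exists (x j / x i); split; last first.
  move=> s sH; rewrite !rmorphM !fmorphV normrM normfV.
  by rewrite ltr_pdivrMr ?normr_gt0 ?fmorph_eq0 ?x_neq0 // mul1r decr.
split; [|split].
- have -> : x j / x i = 1 + D%:R / x i * z by rewrite xij; field.
  by apply: alg_intD; [apply: alg_int1 | apply: alg_intM].
- by rewrite mulf_neq0 ?invr_neq0.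
have -> : (x j / x i)^-1 = 1 - D%:R / x j * z.
  have -> : D%:R / x j * z = (x j - x i) / x j by rewrite xij; field; rewrite -xij.
  by field; rewrite !x_neq0.
by apply: alg_intB; [apply: alg_int1 | apply: alg_intM].
Qed.

(** * Finiteness of the algebraic integers with bounded conjugates *)

(** Each factor [X - a] multiplies a bound on the coefficients by at most [1 + B]. *)
Lemma coef_prod_XsubC_le (B : algC) (r : seq algC) (i : nat) : 0 <= B ->
  {in r, forall a, `|a| <= B} ->
  `|(\prod_(a <- r) ('X - a%:P))`_i| <= (1 + B) ^+ size r.
Proof.
move=> B0; have B1 n : 0 <= (1 + B) ^+ n by rewrite exprn_ge0 // addr_ge0.
elim: r i => [|a r IHr] i rB.
  by rewrite big_nil coef1; case: eqP => _; rewrite ?normr1 ?normr0.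
rewrite big_cons mulrBl coefB coefXM coefCM exprS mulrDl mul1r.
apply: le_trans (ler_normB _ _) _; have IH k : `|(\prod_(b <- r) ('X - b%:P))`_k| <= (1 + B) ^+ size r.
  by apply: IHr => x xr; apply: rB; rewrite inE xr orbT.
apply: lerD; first by case: eqP => _; rewrite ?normr0.
by rewrite normrM ler_pM // rB // mem_head.
Qed.

(** The characteristic polynomial of [x] has integer coefficients bounded by [M], so it is one of
    finitely many; the roots of all of these are listed. *)
Lemma bounded_alg_ints_finite (B : nat) : exists S : seq algC, forall x : L,
  is_alg_int x -> (forall s : G, `|iota (s x)| <= B%:R) -> iota x \in S.
Proof.
pose M := ((1 + B) ^ #|{: G}|)%N.
(* Values in [0 .. 2M], shifted by [M], encode coefficients between [-M] and [M]. *)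
pose P (f : {ffun 'I_(#|{: G}|.+1) -> 'I_(2 * M).+1}) : {poly algC} :=
  \poly_(i < #|{: G}|.+1) ((f (inord i))%:R - M%:R).
pose S f : seq algC := sval (closed_field_poly_normal (P f)).
exists (flatten [seq S f | f : {ffun 'I_(#|{: G}|.+1) -> 'I_(2 * M).+1}]).
move=> x xint xB.
pose Q := map_poly iota (gal_poly x).
have QE : Q = \prod_(a <- [seq iota (s x) | s : G]) ('X - a%:P).
  rewrite /Q /gal_poly rmorph_prod big_map big_enum; apply: eq_bigr => s _.
  by rewrite rmorphB /= map_polyX map_polyC.
have Q_le i : `|Q`_i| <= M%:R.
  rewrite QE; apply: le_trans (@coef_prod_XsubC_le B%:R _ i (ler0n _ _) _) _.
    by move=> _ /mapP[s _ ->].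
  by rewrite size_map -cardE /M natrX natrD.
have Q_size : size Q = #|{: G}|.+1.
  by rewrite QE size_prod_XsubC size_map -cardE.
have Q_int i : exists z : int, Q`_i = z%:~R.
  apply/intrP/Cint_rat_Aint.
    have [p gp] := gal_poly_rat iota x.
    by rewrite /Q gp !coef_map /= rmorph_in_alg Crat_rat.
  move: i; apply/polyOverP; rewrite QE big_map rpred_prod // => s _.
  by rewrite rpredB ?polyOverX // polyOverC alg_int_Aint //; apply: alg_int_rmorph.
have [z zE] := boolp.choice Q_int.
have z_le i : (`|z i| <= M)%N.
  by have := Q_le i; rewrite zE -intr_norm -[M%:R]/(M%:Z%:~R) ler_int; lia.
pose f : {ffun 'I_(#|{: G}|.+1) -> 'I_(2 * M).+1} :=
  [ffun i : 'I_(#|{: G}|.+1) => inord (absz (z i + M%:Z))].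
have PQ : P f = Q.
  apply/polyP=> i; rewrite coef_poly; case: ltnP => [i_lt|i_ge]; last first.
    by rewrite nth_default // Q_size.
  rewrite ffunE inordK inordK //; last by have := z_le i; lia.
  rewrite zE -[_%:R in LHS]/(_%:Z%:~R) gez0_abs; last by have := z_le i; lia.
  by rewrite rmorphD /= addrK.
apply/flattenP; exists (S f); first by apply: map_f; rewrite mem_enum.
rewrite /S; case: closed_field_poly_normal => r /= rE.
have : root (P f) (iota x).
  by rewrite PQ QE root_prod_XsubC; apply/mapP; exists 1%g; rewrite ?mem_enum ?gal_id.
rewrite rE rootZ ?root_prod_XsubC // lead_coef_eq0 PQ -size_poly_eq0 Q_size //.
Qed.
End DirichletUnitExists.

(** * Units modulo roots of unity *)

Section UnitsModuloTorsion.
Variable L : fieldExtType rat.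
Implicit Types (x y z : L).

(** Equality in [F_l]. It forces both sides to be nonzero, since a quotient involving 0 is 0, which
    is not a root of unity. *)
Definition eqt x y := is_root_of_unity (x / y).

Lemma root_of_unity1 : is_root_of_unity (1 : L).
Proof. by exists 1%N; rewrite expr1n. Qed.

Lemma root_of_unity_neq0 x : is_root_of_unity x -> x != 0.
Proof.
case=> n [n0 xn]; apply: contraTneq (oner_neq0 L) => x0; rewrite negbK.
by rewrite -xn x0 expr0n gtn_eqF.
Qed.

Lemma root_of_unityM x y :
  is_root_of_unity x -> is_root_of_unity y -> is_root_of_unity (x * y).
Proof.
case=> m [m0 xm] [n [n0 yn]]; exists (m * n)%N; rewrite muln_gt0 m0.
by rewrite exprMn exprM xm expr1n [(m * n)%N]mulnC exprM yn expr1n mulr1.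
Qed.

Lemma root_of_unityV x : is_root_of_unity x -> is_root_of_unity x^-1.
Proof. by case=> n [n0 xn]; exists n; rewrite exprVn xn invr1. Qed.

Lemma root_of_unityX x n : is_root_of_unity x -> is_root_of_unity (x ^+ n).
Proof. by case=> m [m0 xm]; exists m; rewrite exprAC xm expr1n. Qed.

Lemma root_of_unity_root x n : (0 < n)%N -> is_root_of_unity (x ^+ n) ->
  is_root_of_unity x.
Proof.
move=> n0 [m [m0 xm]]; exists (n * m)%N.
by rewrite muln_gt0 n0 m0 exprM.
Qed.

Lemma eqt_neq0 x y : eqt x y -> x != 0 /\ y != 0.
Proof.
move/root_of_unity_neq0; rewrite mulf_eq0 invr_eq0 negb_or.
by case/andP.
Qed.

Lemma eqt_refl x : x != 0 -> eqt x x.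
Proof. by move=> x0; rewrite /eqt divff //; apply: root_of_unity1. Qed.

Lemma eqt_sym x y : eqt x y -> eqt y x.
Proof. by move/root_of_unityV; rewrite invf_div. Qed.

Lemma eqt_trans y x z : eqt x y -> eqt y z -> eqt x z.
Proof.
move=> xy yz; have [_ y0] := eqt_neq0 xy.
have -> : eqt x z = is_root_of_unity ((x / y) * (y / z)) by rewrite mulrA divfK.
exact: root_of_unityM.
Qed.

Lemma eqtM x y x' y' : eqt x y -> eqt x' y' -> eqt (x * x') (y * y').
Proof. by move=> h h'; rewrite /eqt invfM mulrACA; apply: root_of_unityM. Qed.

Lemma eqtV x y : eqt x y -> eqt x^-1 y^-1.
Proof. by move/root_of_unityV; rewrite invfM. Qed.

Lemma eqtX n x y : eqt x y -> eqt (x ^+ n) (y ^+ n).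
Proof. by rewrite /eqt -expr_div_n; apply: root_of_unityX. Qed.

Lemma eqtXz (k : int) x y : eqt x y -> eqt (x ^ k) (y ^ k).
Proof. by case: k => n h; [apply: eqtX | apply/eqtV/eqtX]. Qed.

Lemma eqt_prod (I : finType) (F F' : I -> L) :
  (forall i, eqt (F i) (F' i)) -> eqt (\prod_i F i) (\prod_i F' i).
Proof.
move=> h; apply: (big_ind2 eqt) => //; first exact: (eqt_refl (oner_neq0 _)).
by move=> *; apply: eqtM.
Qed.

Lemma eqt1 x : eqt x 1 <-> is_root_of_unity x.
Proof. by rewrite /eqt divr1. Qed.

Lemma OK_unit_neq0 x : is_OK_unit x -> x != 0.
Proof. by case=> _ []. Qed.

Lemma OK_unit1 : is_OK_unit (1 : L).
Proof. by rewrite /is_OK_unit invr1 oner_neq0; do !split; exact: alg_int1. Qed.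

Lemma OK_unitM x y : is_OK_unit x -> is_OK_unit y -> is_OK_unit (x * y).
Proof.
case=> x1 [x0 x2] [y1 [y0 y2]]; split; first exact: alg_intM.
by split; [rewrite mulf_neq0 | rewrite invfM; apply: alg_intM].
Qed.

Lemma OK_unitV x : is_OK_unit x -> is_OK_unit x^-1.
Proof. by case=> x1 [x0 x2]; rewrite /is_OK_unit invrK invr_neq0. Qed.

Lemma OK_unit_div x y : is_OK_unit x -> is_OK_unit y -> is_OK_unit (x / y).
Proof. by move=> ux /OK_unitV; apply: OK_unitM. Qed.

Lemma OK_unitXz (k : int) x : is_OK_unit x -> is_OK_unit (x ^ k).
Proof.
move=> ux; have uX n : is_OK_unit (x ^+ n).
  by elim: n => [|n IHn]; [apply: OK_unit1 | rewrite exprS; apply: OK_unitM].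
by case: k => n; [apply: uX | apply/OK_unitV/uX].
Qed.

Lemma OK_unit_prod (I : finType) (F : I -> L) :
  (forall i, is_OK_unit (F i)) -> is_OK_unit (\prod_i F i).
Proof.
move=> h; apply: (big_ind (@is_OK_unit L)) => //; first exact: OK_unit1.
exact: OK_unitM.
Qed.

(** Monomials with exponents in a row vector: changes of generators become products of integer
    matrices, see [mon_mulmx]. *)
Definition mon n (g : 'I_n -> L) (v : 'rV[int]_n) : L := \prod_i g i ^ v 0 i.

Lemma mon_unit n (g : 'I_n -> L) v : (forall i, is_OK_unit (g i)) -> is_OK_unit (mon g v).
Proof. by move=> gu; apply: OK_unit_prod => i; apply: OK_unitXz. Qed.

Lemma mon_neq0 n (g : 'I_n -> L) v : (forall i, g i != 0) -> mon g v != 0.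
Proof. by move=> g0; apply/prodf_neq0 => i _; rewrite expfz_neq0. Qed.

Lemma mon0 n (g : 'I_n -> L) : mon g 0 = 1.
Proof. by apply: big1 => i _; rewrite mxE expr0z. Qed.

Lemma monD n (g : 'I_n -> L) u v : (forall i, g i != 0) ->
  mon g (u + v) = mon g u * mon g v.
Proof.
move=> g0; rewrite /mon -big_split; apply: eq_bigr => i _ /=.
by rewrite mxE expfzDr.
Qed.

Lemma monZ n (g : 'I_n -> L) (k : int) v : (forall i, g i != 0) ->
  mon g (k *: v) = mon g v ^ k.
Proof.
move=> g0; have -> : mon g v ^ k = \prod_i (g i ^ v 0 i) ^ k.
  rewrite /mon; elim/big_rec2: _ => [|i _ y _ <-]; first by rewrite exp1rz.
  by rewrite expfzMl.
by apply: eq_bigr => i _; rewrite mxE exprz_exp mulrC.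
Qed.

Lemma monN n (g : 'I_n -> L) v : (forall i, g i != 0) -> mon g (- v) = (mon g v)^-1.
Proof. by move=> g0; rewrite -scaleN1r monZ. Qed.

Lemma monB n (g : 'I_n -> L) u v : (forall i, g i != 0) ->
  mon g (u - v) = mon g u / mon g v.
Proof. by move=> g0; rewrite monD // monN. Qed.

Lemma mon_mulmx m n (g : 'I_n -> L) (k : 'rV[int]_m) (M : 'M[int]_(m, n)) :
  (forall i, g i != 0) -> mon g (k *m M) = mon (fun i => mon g (row i M)) k.
Proof.
move=> g0; rewrite mulmx_sum_row.
rewrite (big_morph (mon g) (fun u v => monD u v g0) (mon0 g)).
by apply: eq_bigr => i _; rewrite monZ.
Qed.

Lemma mon_eqt n (g g' : 'I_n -> L) v : (forall i, eqt (g i) (g' i)) ->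
  eqt (mon g v) (mon g' v).
Proof. by move=> h; apply: eqt_prod => i; apply: eqtXz. Qed.

Lemma mon_expr n (g : 'I_n -> L) v N : mon (fun i => g i ^+ N) v = mon g v ^+ N.
Proof.
rewrite /mon -prodrXl; apply: eq_bigr => i _.
by rewrite !exprnP !exprz_exp mulrC.
Qed.

Lemma mult_indep_mon n (y : 'I_n -> L) (k : 'rV[int]_n) :
  mult_indep y -> is_root_of_unity (mon y k) -> k = 0.
Proof. by move=> yi /yi h; apply/rowP=> i; rewrite h mxE. Qed.

Lemma mon_indep n (y : 'I_n -> L) :
  (forall k : 'rV[int]_n, is_root_of_unity (mon y k) -> k = 0) -> mult_indep y.
Proof.
move=> h k kt i; have /rowP/(_ i) : (\row_i k i : 'rV[int]_n) = 0.
  apply: h; rewrite (_ : mon y _ = \prod_(i < n) y i ^ k i) //.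
  by apply: eq_bigr => j _; rewrite mxE.
by rewrite !mxE.
Qed.

(** A relation [k *m M = 0] makes the [N]-th power of [mon y k] a root of unity, hence also
    [mon y k] itself. *)
Lemma mult_indep_free m n (y : 'I_m -> L) (g : 'I_n -> L) (N : nat)
    (M : 'M[int]_(m, n)) :
  mult_indep y -> (0 < N)%N -> (forall i, g i != 0) ->
  (forall i, eqt (y i ^+ N) (mon g (row i M))) ->
  forall k : 'rV[int]_m, k *m M = 0 -> k = 0.
Proof.
move=> yi N0 g0 yM k kM; apply: (mult_indep_mon yi).
apply: (root_of_unity_root N0); rewrite -mon_expr; apply/eqt1.
by rewrite -(mon0 g) -kM mon_mulmx //; apply: mon_eqt.
Qed.

Lemma in_genE n (g : 'I_n -> L) x :
  in_gen g x <-> is_OK_unit x /\ exists k : 'rV[int]_n, eqt x (mon g k).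
Proof.
split=> -[ux [k h]]; split=> //; last by exists (fun i => k 0 i).
exists (\row_i k i); rewrite (_ : mon g _ = \prod_i g i ^ k i) //.
by apply: eq_bigr => i _; rewrite mxE.
Qed.

Lemma in_gen_rows m n (y : 'I_m -> L) (g : 'I_n -> L) :
  (forall i, in_gen g (y i)) ->
  exists M : 'M[int]_(m, n), forall i, eqt (y i) (mon g (row i M)).
Proof.
move=> yg; have /boolp.choice[k kP] i : exists k : 'rV[int]_n, eqt (y i) (mon g k).
  by have /in_genE[] := yg i.
by exists (\matrix_i k i) => i; rewrite rowK.
Qed.

Lemma mult_indep_leq m n (y : 'I_m -> L) (g : 'I_n -> L) :
  mult_indep y -> (forall i, g i != 0) -> (forall i, in_gen g (y i)) -> (m <= n)%N.
Proof.
move=> yi g0 /in_gen_rows[M yM]; apply: (@int_free_leq m n M).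
by apply: (mult_indep_free (N := 1) yi _ g0) => // i; rewrite expr1.
Qed.

Lemma fundamental_system_size m n (e : 'I_m -> L) (e' : 'I_n -> L) :
  fundamental_system e -> fundamental_system e' -> m = n.
Proof.
case=> eu [ei eg] [eu' [ei' eg']]; apply/eqP; rewrite eqn_leq.
rewrite (mult_indep_leq ei (fun i => OK_unit_neq0 (eu' i))) => [|i]; last exact: eg'.
by rewrite (mult_indep_leq ei' (fun i => OK_unit_neq0 (eu i))) // => i; apply: eg.
Qed.

Lemma mult_indep_inj m n (y : 'I_n -> L) (f : 'I_m -> 'I_n) :
  injective f -> (forall i, y i != 0) -> mult_indep y -> mult_indep (y \o f).
Proof.
move=> finj y0 yi k kt i.
(* The extension of [k] by zero outside the image of [f], written as a sum over fibres. *)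
pose k' j := \sum_(i | f i == j) k i.
have kk' j : k' (f j) = k j.
  rewrite /k' (eq_bigl (pred1 j)) ?big_pred1_eq // => l.
  by rewrite /= (inj_eq finj).
rewrite -kk'; apply: yi; rewrite (_ : \prod_j _ = \prod_i (y \o f) i ^ k i) //.
rewrite (partition_big f xpredT) //=; apply: eq_bigr => j _.
rewrite /k' (big_morph (exprz (y j)) (fun a b => expfzDr a b (y0 j)) (expr0z _)).
by apply: eq_bigr => l /eqP->.
Qed.

(** Comparison of exponents gives [r <= n]; if [r < n], the first [r + 1] members of [e] would be
    independent, against the maximality of [r]. *)
Lemma unit_rank_fundamental r n (e : 'I_n -> L) :
  unit_rank L r -> fundamental_system e -> r = n.
Proof.
case=> [[y [yu yi]] no] [eu [ei eg]]; apply/eqP; rewrite eqn_leq.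
rewrite (mult_indep_leq yi (fun i => OK_unit_neq0 (eu i))) => [|i]; last exact: eg.
rewrite leqNgt; apply/negP=> lt_rn.
apply: (no (e \o widen_ord lt_rn)) => [j|]; first exact: eu.
apply: mult_indep_inj ei => [i j|i]; last exact: OK_unit_neq0.
by move/(congr1 val) => h; apply/val_inj.
Qed.

(** Redundant representatives are discarded one at a time until the remaining ones are pairwise
    inequivalent. *)
Lemma has_index_cover (P : L -> Prop) (m : nat) (u : 'I_m -> L) :
  (forall x y, P x -> P y -> P (x * y)) -> 
  (forall i, is_OK_unit (u i)) ->
  (forall x, is_OK_unit x -> exists i, P (x / u i)) ->
  exists2 n, (n <= m)%N & has_index P n.
Proof.
move=> PM; elim: m u => [|m IHm] u uu cover.
  by exists 0%N => //; exists u; split=> //; split=> // -[].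
have [sep|] := boolp.pselect (forall i j, P (u i / u j) -> i = j).
  by exists m.+1 => //; exists u.
move/boolp.existsNP=> [i /boolp.existsNP[j /boolp.not_implyP[Pij ij]]].
have ne_ij : i != j by apply/eqP.
have [j' jE _] := unlift_some ne_ij.
have [|x ux|n nm nP] := IHm (u \o lift i); first by move=> l; apply: uu.
  have [l Pl] := cover x ux.
  have [il|li] := eqVneq i l; last first.
    by have [l' lE _] := unlift_some li; exists l'; rewrite /= -lE.
  exists j'; rewrite /= -jE (_ : x / u j = x / u i * (u i / u j)).
    by apply: PM Pij; rewrite il.
  by rewrite mulrA divfK ?OK_unit_neq0.
by exists n => //; apply: leqW.
Qed.
End UnitsModuloTorsion.

(** * Logarithmic embedding *)

Section Logarithms.
Variables (L : splittingFieldType rat) (iota : {rmorphism L -> algC}).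
Notation G := (GalQ L).
Implicit Types (s t : G) (x y : L).

Definition lg s x : R := ln (toR `|iota (s x)|).

Lemma lg_norm_gt0 s x : x != 0 -> 0 < toR `|iota (s x)|.
Proof. by move=> x0; rewrite toR_gt0 // normr_gt0 !fmorph_eq0. Qed.

Lemma lgM s x y : x != 0 -> y != 0 -> lg s (x * y) = lg s x + lg s y.
Proof.
move=> x0 y0; rewrite /lg !rmorphM normrM toRM //.
by apply: ln_mult; apply/RltP; apply: lg_norm_gt0.
Qed.

Lemma lg1 s : lg s 1 = 0.
Proof. by rewrite /lg !rmorph1 normr1 (toR_nat 1); apply: ln_1. Qed.

Lemma lgV s x : x != 0 -> lg s x^-1 = - lg s x.
Proof.
move=> x0; apply/eqP; rewrite -addr_eq0 -lgM ?invr_eq0 // mulVf // lg1.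
by [].
Qed.

Lemma lgX s x n : x != 0 -> lg s (x ^+ n) = lg s x *+ n.
Proof.
move=> x0; elim: n => [|n IHn]; first by rewrite lg1.
by rewrite exprS lgM ?expf_neq0 // IHn mulrS.
Qed.

Lemma lgXz s x (k : int) : x != 0 -> lg s (x ^ k) = lg s x * k%:~R.
Proof.
move=> x0; case: k => n; first by rewrite -exprnP lgX // mulr_natr.
rewrite -[x ^ _]/((x ^+ n.+1)^-1) lgV ?expf_neq0 // lgX // NegzE.
by rewrite mulrNz mulrN -mulr_natr.
Qed.

Lemma lg_root_of_unity s x : is_root_of_unity x -> lg s x = 0.
Proof.
move=> xt; have x0 := root_of_unity_neq0 xt; case: xt => n [n0 xn].
have := lg1 s; rewrite -xn lgX // => /eqP.
by rewrite mulrn_eq0 eqn0Ngt n0 /= => /eqP.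
Qed.

Lemma lg_eqt s x y : eqt x y -> lg s x = lg s y.
Proof.
move=> xy; have [x0 y0] := eqt_neq0 xy; have := lg_root_of_unity s xy.
by rewrite lgM ?invr_eq0 // lgV // => /eqP; rewrite subr_eq0 => /eqP.
Qed.

Lemma lg_mon n (g : 'I_n -> L) v s : (forall i, g i != 0) ->
  lg s (mon g v) = \sum_i (v 0 i)%:~R * lg s (g i).
Proof.
move=> g0; rewrite /mon; pose K (x : L) (y : R) := x != 0 /\ lg s x = y.
suff [] : K (\prod_i g i ^ v 0 i) (\sum_i (v 0 i)%:~R * lg s (g i)) by [].
apply: (big_ind2 K); first by rewrite /K oner_neq0 lg1.
  by move=> x1 y1 x2 y2 [x10 <-] [x20 <-]; rewrite /K mulf_neq0 // lgM.
by move=> i _; rewrite /K expfz_neq0 // lgXz // mulrC.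
Qed.

Lemma lg_gal s t x : lg s (t x) = lg (t * s)%g x.
Proof. by rewrite /lg galME. Qed.

Lemma lg_lt0 s x : x != 0 -> `|iota (s x)| < 1 -> lg s x < 0.
Proof.
move=> x0 x1; apply/RltP; rewrite -[X in Rlt _ X]ln_1; apply: ln_increasing; apply/RltP.
  exact: lg_norm_gt0.
rewrite -[X in _ < X](toR_nat 1) toR_lt //; exact: ger0_real.
Qed.

(** The product formula for units, in logarithmic form. *)
Lemma sum_lg x : is_OK_unit x -> \sum_(s : G) lg s x = 0.
Proof.
move=> ux; have x0 := OK_unit_neq0 ux.
pose K (y : L) (z : R) := y != 0 /\ lg 1%g y = z.
have [_ <-] : K (\prod_(s : G) s x) (\sum_(s : G) lg s x).
  apply: (big_ind2 K); first by rewrite /K oner_neq0 lg1.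
    by move=> x1 y1 x2 y2 [x10 <-] [x20 <-]; rewrite /K mulf_neq0 // lgM.
  by move=> s _; rewrite /K fmorph_eq0 x0 lg_gal mulg1.
rewrite /lg gal_id rmorph_prod normr_prod unit_norm1 // (toR_nat 1).
exact: ln_1.
Qed.

Lemma lg_bound s x (C : R) (n : nat) : x != 0 -> lg s x <= C -> exp C <= n%:R ->
  `|iota (s x)| <= n%:R.
Proof.
move=> x0 xC Cn; rewrite real_leNgt ?realn ?ger0_real //.
rewrite -ltr_toR ?realn ?ger0_real // toR_nat -leNgt.
apply: le_trans Cn; rewrite -[X in X <= _]exp_ln; last by apply/RltP; apply: lg_norm_gt0.
move: xC; rewrite le_eqVlt => /predU1P[<- //|/RltP/exp_increasing/RltP/ltW]; exact.
Qed.

Lemma weil_hE x : (\dim {:L})%:R * weil_h iota x = \sum_(s : G) Num.max 0 (lg s x).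
Proof.
have d0 : (\dim {:L})%:R != 0 :> R by rewrite pnatr_eq0 -lt0n -(card_galQ iota); apply/card_gt0P; exists 1%g.
rewrite /weil_h RdivE INRE mulrCA divff // mulr1.
by apply: eq_bigr => s _; rewrite /lnplus -RmaxE.
Qed.

(** From [2 max(0, a) = |a| + a] and the vanishing of the sum of the logs. *)
Lemma weil_h_unit x : is_OK_unit x ->
  2 * (\dim {:L})%:R * weil_h iota x = \sum_(s : G) `|lg s x|.
Proof.
move=> ux; rewrite -mulrA weil_hE mulr_sumr -[RHS]addr0 -[X in _ = _ + X](sum_lg ux) -big_split.
apply: eq_bigr => s _ /=; rewrite /Num.max; case: ltP => h.
  by rewrite gtr0_norm // mulr2n mulrDl mul1r.
by rewrite mulr0 ler0_norm // addNr.
Qed.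

End Logarithms.

(** * Log matrices over distinct places *)

Section LogMatrices.
Variables (L : splittingFieldType rat) (iota : {rmorphism L -> algC}).
Notation G := (GalQ L).
Variable c : G.
Hypothesis cE : forall x, iota (c x) = (iota x)^*.
Implicit Types (s t : G) (x y : L).
Notation H := [set 1%g; c].
Notation lg := (lg iota).

Lemma lg_mul_conj s x : lg (s * c)%g x = lg s x.
Proof. by congr (ln (toR _)); apply: norm_mul_conj. Qed.

Lemma conj_mulV s t : s \in H -> t \in H -> (s * t^-1)%g \in H.
Proof.
have cV : c^-1%g = c by apply/eqP; rewrite eq_invg_mul (conj_galK cE).
by rewrite !inE => /orP[] /eqP-> /orP[] /eqP->;
  rewrite ?invg1 ?mulg1 ?cV ?mul1g ?(conj_galK cE) eqxx ?orbT.
Qed.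

(* The complex embeddings [iota \o tau i] lie over distinct places. *)
Definition separated n (tau : 'I_n -> G) :=
  forall i j, i != j -> ((tau j)^-1 * tau i)%g \notin H.

Definition covered n (tau : 'I_n -> G) s := [exists i, ((tau i)^-1 * s)%g \in H].

(** The cosets of [H] through the [tau i] are disjoint, and [f] is constant on each. This passes
    between sums over places and sums over embeddings. *)
Lemma coset_sum n (tau : 'I_n -> G) (f : G -> R) :
  separated tau -> (forall s, f (s * c)%g = f s) ->
  #|H|%:R * (\sum_i f (tau i)) = \sum_(s | covered tau s) f s.
Proof.
move=> sep fc; transitivity (\sum_i \sum_(s | ((tau i)^-1 * s)%g \in H) f s).
  rewrite mulr_sumr; apply: eq_bigr => i _.
  rewrite (reindex_inj (mulgI (tau i))) /=.
  rewrite (eq_bigl (fun s => s \in H)) => [|s]; last by rewrite mulKg.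
  rewrite (eq_bigr (fun=> f (tau i))); last first.
    by move=> s; rewrite !inE => /orP[] /eqP->; rewrite ?mulg1 ?fc.
  by rewrite sumr_const mulr_natl.
rewrite (exchange_big_dep (covered tau)) /=; last first.
  by move=> i s _ h; apply/existsP; exists i.
apply: eq_bigr => s /existsP[i0 i0s].
rewrite (eq_bigl (pred1 i0)) ?big_pred1_eq // => i /=.
have [-> //|ii0] := eqVneq i i0; apply/negbTE; apply: contraNN (sep _ _ ii0) => h.
have -> : ((tau i0)^-1 * tau i = (tau i0)^-1 * s * ((tau i)^-1 * s)^-1)%g.
  by rewrite invMg invgK !mulgA mulgK.
exact: conj_mulV.
Qed.

Lemma card_covered n (tau : 'I_n -> G) : separated tau ->
  (n * #|H|)%N = #|[pred s | covered tau s]|.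
Proof.
move=> sep; apply/eqP; rewrite -(eqr_nat R) natrM mulrC.
have := coset_sum (f := fun=> 1) sep (fun=> erefl).
rewrite sumr_const card_ord => ->; rewrite -sum1_card natr_sum.
by apply/eqP; apply: eq_bigl.
Qed.

Lemma place_reps : exists p (tau : 'I_p.+1 -> G),
  [/\ separated tau, forall s, covered tau s & (p.+1 * #|H|)%N = #|{: G}|].
Proof.
(* Each coset [{s, s c}] is represented by its member of smaller rank in the enumeration of [G]. *)
pose rep s := if (enum_rank s <= enum_rank (s * c)%g)%N then s else (s * c)%g.
have scc s : (s * c * c)%g = s by rewrite -mulgA (conj_galK cE) mulg1.
have rep_conj s : rep (s * c)%g = rep s.
  rewrite /rep scc; case: (ltngtP (enum_rank s) (enum_rank (s * c)%g)) => //.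
  by move=> /val_inj/enum_rank_inj <-.
have rep_rep s : rep (rep s) = rep s by rewrite {2}/rep; case: ifP; rewrite ?rep_conj.
have rep_H s : ((rep s)^-1 * s)%g \in H.
  rewrite /rep; case: ifP => _; first by rewrite mulVg !inE eqxx.
  by rewrite -{2}[s]scc mulKg !inE eqxx orbT.
pose T := [set rep s | s : G].
have [p pE] : exists p, #|T| = p.+1.
  exists #|T|.-1; rewrite prednK //; apply/card_gt0P.
  by exists (rep 1%g); apply: imset_f.
pose tau i : G := enum_val (cast_ord (esym pE) i).
have tau_rep i : rep (tau i) = tau i.
  by have /imsetP[s _] := enum_valP (cast_ord (esym pE) i); rewrite /tau => ->.
have sep : separated tau.
  move=> i j; apply: contraNN => h; apply/eqP.
  suff : tau i = tau j by move/enum_val_inj/cast_ord_inj.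
  rewrite -(tau_rep i) -(tau_rep j) -[tau i](mulKVg (tau j)).
  by move: h; rewrite !inE => /orP[] /eqP->; rewrite ?mulg1 ?rep_conj.
have cov s : covered tau s.
  have Ts : rep s \in T by apply: imset_f.
  apply/existsP; exists (cast_ord pE (enum_rank_in Ts (rep s))).
  by rewrite /tau cast_ordK enum_rankK_in.
exists p, tau; split=> //.
rewrite (card_covered sep); apply: eq_card => s; rewrite !inE; exact: cov.
Qed.

Definition logmx n (tau : 'I_n -> G) (e : 'I_n -> L) : 'M[R]_n :=
  \matrix_(i, j) lg (tau j) (e i).

Lemma logmx_mon n (tau : 'I_n -> G) (e y : 'I_n -> L) (M : 'M[int]_n) :
  (forall i, e i != 0) -> (forall i, eqt (y i) (mon e (row i M))) ->
  logmx tau y = map_mx intr M *m logmx tau e.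
Proof.
move=> e0 yM; apply/matrixP=> i j; rewrite !mxE (lg_eqt iota _ (yM i)) lg_mon //.
by apply: eq_bigr => k _; rewrite !mxE.
Qed.

Lemma logmx_indep n (tau : 'I_n -> G) (e : 'I_n -> L) :
  (forall i, e i != 0) -> \det (logmx tau e) != 0 -> mult_indep e.
Proof.
move=> e0 d0; apply: mon_indep => k kt.
have kl : (map_mx intr k : 'rV[R]_n) *m logmx tau e = 0.
  apply/rowP=> j; rewrite !mxE -[RHS](lg_root_of_unity iota (tau j) kt) lg_mon //.
  by apply: eq_bigr => i _; rewrite !mxE.
have : (map_mx intr k : 'rV[R]_n) = 0.
  by rewrite -[LHS](mulmxK (_ : logmx tau e \in unitmx)) ?kl ?mul0mx // unitmxE unitfE.
move/rowP=> k0; apply/rowP=> j; have /eqP := k0 j.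
by rewrite !mxE intr_eq0 => /eqP.
Qed.

Definition contracting x := forall s, s \notin H -> lg s x < 0.

(** Outside [H] all logs are negative and the total is zero, so the positive part is exactly the
    contribution of [H]. *)
Lemma contracting_height x : is_OK_unit x -> contracting x ->
  \sum_(s : G) Num.max 0 (lg s x) = #|H|%:R * lg 1%g x.
Proof.
move=> ux xc.
have sumH : \sum_(s in H) lg s x = #|H|%:R * lg 1%g x.
  rewrite (eq_bigr (fun=> lg 1%g x)) ?sumr_const ?mulr_natl // => s.
  by rewrite !inE => /orP[] /eqP -> //; rewrite -[c]mul1g lg_mul_conj.
have lg1_ge0 : 0 <= lg 1%g x.
  have H0 : 0 < #|H|%:R :> R by rewrite ltr0n; apply/card_gt0P; exists 1%g; rewrite !inE eqxx.
  rewrite -(pmulr_rge0 _ H0) -sumH.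
  have := sum_lg iota ux; rewrite (bigID (mem H)) /= => /eqP.
  rewrite addr_eq0 => /eqP ->; rewrite -sumrN; apply: sumr_ge0 => s sH.
  by rewrite oppr_ge0 ltW // xc.
rewrite (bigID (mem H)) /= -sumH [X in _ + X]big1 ?addr0 => [|s sH]; last first.
  by apply/max_idPl/ltW/xc.
apply: eq_bigr => s sH; apply/max_idPr.
by move: sH; rewrite !inE => /orP[] /eqP -> //; rewrite -[c]mul1g lg_mul_conj.
Qed.

(** With inverses in the conjugates, the log matrix has entries at [(tau i)^-1 * tau j]: negative
    off the diagonal, and [lg 1 x] on it. Scaled by [#|H|], it falls under [det_offdiag_le0]. *)
Lemma conj_logmx n (tau : 'I_n -> G) x : separated tau ->
  (n * #|H| < #|{: G}|)%N -> is_OK_unit x -> contracting x ->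
  0 < \det (logmx tau (fun k => (tau k)^-1%g x)) /\
  #|H|%:R ^+ n * \det (logmx tau (fun k => (tau k)^-1%g x)) <=
    (\sum_(s : G) Num.max 0 (lg s x)) ^+ n.
Proof.
move=> sep lt_n ux xc; set M := logmx _ _.
have H0 : 0 < #|H|%:R :> R by rewrite ltr0n; apply/card_gt0P; exists 1%g; rewrite !inE eqxx.
pose A : 'M[R]_n := #|H|%:R *: M.
have AE i j : A i j = #|H|%:R * lg ((tau i)^-1 * tau j)%g x.
  by rewrite !mxE lg_gal.
have off i j : i != j -> A i j <= 0.
  move=> ij; rewrite AE pmulr_rle0 // ltW //; apply: xc; apply: sep.
  by rewrite eq_sym.
have rows i : 0 < \sum_j A i j.
  pose tau' j := ((tau i)^-1 * tau j)%g.
  have sep' : separated tau'.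
    by move=> j k jk; rewrite /tau' invMg invgK mulgA mulgK; apply: sep.
  have -> : \sum_j A i j = \sum_(s | covered tau' s) lg s x.
    rewrite -(coset_sum sep') => [|s]; last exact: lg_mul_conj.
    by rewrite mulr_sumr; apply: eq_bigr => j _; rewrite AE.
  (* The row sum is minus the sum over uncovered embeddings; these exist because [n #|H| < #|G|],
     and their logs are negative as the identity coset is covered. *)
  have := sum_lg iota ux; rewrite (bigID (covered tau')) /= => /eqP.
  rewrite addr_eq0 => /eqP ->.
  have neg s : ~~ covered tau' s -> lg s x < 0.
    move=> ns; apply: xc; apply: contraNN ns => sH; apply/existsP; exists i.
    by rewrite /tau' mulVg invg1 mul1g.
  have [s0 s0P] : exists s, ~~ covered tau' s.
    apply/existsP; rewrite -negb_forall; apply/negP=> /forallP all_cov.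
    move: lt_n; rewrite (card_covered sep') ltnNge; case/negP.
    by apply: subset_leq_card; apply/subsetP => s _; apply: all_cov.
  rewrite oppr_gt0 (bigD1 s0) //= -[X in _ < X]addr0; apply: ltr_leD; first exact: neg.
  by apply: sumr_le0 => s /andP[ns _]; apply/ltW/neg.
have /andP[dA_gt0 dA_le] := det_offdiag_le0 off rows.
have dA : \det A = #|H|%:R ^+ n * \det M by rewrite detZ.
split; first by move: dA_gt0; rewrite dA pmulr_rgt0 ?exprn_gt0.
rewrite -dA; apply: le_trans dA_le _; rewrite contracting_height //.
rewrite (eq_bigr (fun=> #|H|%:R * lg 1%g x)) ?prodr_const ?card_ord // => i _.
by rewrite AE mulVg.
Qed.

(** Coordinates are found by inverting the matrix at [p] of the [p + 1] places. The difference [w]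
    vanishes there, and at the last place because its sum is zero. *)
Lemma log_span p (tau : 'I_p.+1 -> G) (e : 'I_p -> L) (v : G -> R) :
  separated tau -> (forall s, covered tau s) -> (forall i, is_OK_unit (e i)) ->
  \det (logmx (fun j => tau (lift ord_max j)) e) != 0 ->
  (forall s, v (s * c)%g = v s) -> \sum_(s : G) v s = 0 ->
  exists t : 'I_p -> R, forall s, v s = \sum_j t j * lg s (e j).
Proof.
move=> sep cov eu d0 vc v0; set M := logmx _ _ in d0.
pose t : 'rV[R]_p := (\row_j v (tau (lift ord_max j))) *m invmx M.
have tM : t *m M = \row_j v (tau (lift ord_max j)).
  by rewrite mulmxKV // unitmxE unitfE.
exists (fun j => t 0 j) => s; apply/eqP; rewrite -subr_eq0.
pose w s := v s - \sum_j t 0 j * lg s (e j); rewrite -/(w s).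
have wc s' : w (s' * c)%g = w s'.
  by rewrite /w vc; under eq_bigr do rewrite lg_mul_conj.
have w_lift j : w (tau (lift ord_max j)) = 0.
  apply/eqP; rewrite subr_eq0; have /rowP/(_ j) := tM; rewrite !mxE => <-.
  by apply/eqP; apply: eq_bigr => i _; rewrite !mxE.
have w_sum : \sum_(s : G) w s = 0.
  rewrite /w sumrB v0 exchange_big /= big1 ?subr0 // => j _.
  by rewrite -mulr_sumr sum_lg ?mulr0.
have H0 : #|H|%:R != 0 :> R by rewrite pnatr_eq0 -lt0n; apply/card_gt0P; exists 1%g; rewrite !inE eqxx.
have w_max : w (tau ord_max) = 0.
  have := coset_sum sep wc.
  have -> : \sum_(s' | covered tau s') w s' = 0.
    by rewrite -[RHS]w_sum; apply: eq_bigl => s'; rewrite cov.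
  move/eqP; rewrite mulf_eq0 (negbTE H0) /= big_ord_recr /= big1 ?add0r => [/eqP //|j _].
  rewrite -[RHS](w_lift j); congr (w (tau _)); apply/val_inj => /=.
  by rewrite /bump leqNgt ltn_ord.
have w_tau i : w (tau i) = 0.
  have [->//|im] := eqVneq i ord_max.
  by rewrite eq_sym in im; have [j -> _] := unlift_some im.
have /existsP[i] := cov s; rewrite -[s in w s](mulKVg (tau i)) !inE.
by case/orP=> /eqP ->; rewrite ?mulg1 ?wc w_tau.
Qed.

End LogMatrices.

(** * Fundamental systems and the regulator *)

Section FundamentalSystem.
Variables (L : splittingFieldType rat) (iota : {rmorphism L -> algC}).
Notation G := (GalQ L).
Notation lg := (lg iota).
Notation logmx := (logmx iota).

Lemma OK_unit_gal (s : G) (x : L) : is_OK_unit x -> is_OK_unit (s x).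
Proof.
case=> x1 [x0 x2]; rewrite /is_OK_unit -fmorphV fmorph_eq0.
by do !split=> //; apply: alg_int_rmorph.
Qed.

(** Removing integer parts of log coordinates sends every power of [u] into a finite set [S]. Two
    powers of exponent at most [size S] share a remainder, and the gap between their exponents
    divides the factorial, which makes [N] uniform in [u]. *)
Lemma power_in_span (c : G) p (tau : 'I_p.+1 -> G) (xi : 'I_p -> L) :
  (forall x, iota (c x) = (iota x)^*) ->
  separated c tau -> (forall s, covered c tau s) -> (forall i, is_OK_unit (xi i)) ->
  \det (logmx (fun j => tau (lift ord_max j)) xi) != 0 ->
  exists2 N : nat, (0 < N)%N &
    forall u : L, is_OK_unit u -> exists v, u ^+ N = mon xi v.
Proof.
move=> cE sep cov xiu d0; have xi0 i := OK_unit_neq0 (xiu i).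
(* A bound for all logs of a combination of the [xi j] with coordinates in [[0, 1)]. *)
pose C : R := \sum_(s : G) \sum_j `|lg s (xi j)|.
pose n := (Num.truncn (exp C)).+1.
have Cn : exp C <= n%:R by apply/ltW/truncnS_gt.
have [S hS] := bounded_alg_ints_finite iota n.
exists (size S)`!; rewrite ?fact_gt0 // => u uu; have u0 := OK_unit_neq0 uu.
have reduce i : exists a : 'rV[int]_p, iota (u ^+ i / mon xi a) \in S.
  have ui : is_OK_unit (u ^+ i) by rewrite exprnP; apply: OK_unitXz.
  have [||t tE] := log_span cE (v := fun s => lg s (u ^+ i)) sep cov xiu d0.
  - by move=> s; apply: lg_mul_conj.
  - exact: sum_lg.
  pose a : 'rV[int]_p := \row_j Num.floor (t j); exists a.
  have au : is_OK_unit (mon xi a) by apply: mon_unit.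
  have wu : is_OK_unit (u ^+ i / mon xi a) by apply: OK_unit_div.
  apply: hS => [|s]; first by case: wu.
  apply: (lg_bound (OK_unit_neq0 wu) _ Cn).
  rewrite lgM ?lgV ?invr_eq0 ?(OK_unit_neq0 au) ?(OK_unit_neq0 ui) // tE lg_mon //.
  rewrite -sumrB; apply: le_trans (_ : \sum_j `|lg s (xi j)| <= _); last first.
    by rewrite /C (bigD1 s) //= lerDl sumr_ge0 // => s' _; apply: sumr_ge0.
  apply: ler_sum => j _; rewrite mxE -mulrBl.
  apply: le_trans (ler_norm _) _; rewrite normrM ler_piMl //.
  have := floor_le (t j); have := floorD1_gt (t j).
  by rewrite intrD => h1 h2; rewrite ger0_norm; lra.
have [a aS] := boolp.choice reduce.
pose w i := u ^+ i / mon xi (a i).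
have : ~~ injectiveb (fun i : 'I_(size S).+1 => iota (w i)).
  apply/negP=> /injectiveP inj.
  suff : (size [seq iota (w i) | i : 'I_(size S).+1] <= size S)%N.
    by rewrite size_map size_enum_ord ltnn.
  apply: uniq_leq_size; first by rewrite map_inj_uniq // enum_uniq.
  move=> _ /mapP[i _ ->]. exact: aS.
case/injectivePn=> i0 [j0 ij0 /fmorph_inj wij0].
have {ij0 wij0} [i [j [ij jS wij]]] : exists i j : nat,
    [/\ (i < j)%N, (j <= size S)%N & w i = w j].
  case: (ltngtP i0 j0) => h; [exists i0, j0 | exists j0, i0 |].
  - by split; rewrite // -ltnS.
  - by split; rewrite // -ltnS.
  - by case/negP: ij0; apply/eqP/val_inj.
have ui : u ^+ (j - i) = mon xi (a j - a i).
  have aj0 := mon_neq0 (a j) xi0; have ai0 := mon_neq0 (a i) xi0.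
  have ui0 : u ^+ i != 0 by rewrite expf_neq0.
  have uj : u ^+ j = u ^+ (j - i) * u ^+ i by rewrite -exprD subnK // ltnW.
  apply: (mulIf ui0); rewrite -uj -[LHS](divfK aj0) -[_ / _]wij monB //.
  by rewrite /w [RHS]mulrC -mulrA [_^-1 * _]mulrC.
have [k kE] : exists k, (size S)`! = ((j - i) * k)%N.
  have : (j - i %| (size S)`!)%N.
    by apply: dvdn_fact; rewrite subn_gt0 ij (leq_trans (leq_subr _ _) jS).
  by case/dvdnP=> k ->; exists k; rewrite mulnC.
exists (k%:Z *: (a j - a i)); rewrite monZ // -exprnP -ui kE exprM //.
Qed.

(** Conjugates of a contracting unit generate a subgroup containing all [N]-th powers of units, so
    the unit group modulo torsion is isomorphic to a full-rank lattice of exponents, which has a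
    basis. *)
Lemma fundamental_system_exists (c : G) :
  (forall x, iota (c x) = (iota x)^*) ->
  exists p (tau : 'I_p.+1 -> G) (e : 'I_p -> L),
    [/\ separated c tau, forall s, covered c tau s,
        (p.+1 * #|[set 1%g; c]|)%N = #|{: G}|,
        fundamental_system e
      & \det (logmx (fun j => tau (lift ord_max j)) e) != 0].
Proof.
move=> cE; have [p [tau [sep cov cardG]]] := place_reps cE.
have [u0 [u0u u0c]] := contracting_unit cE.
have u0_contr : contracting iota c u0.
  by move=> s /u0c h; apply: lg_lt0 h; apply: OK_unit_neq0.
pose tau' j := tau (lift ord_max j).
have sep' : separated c tau'.
  by move=> i j ij; apply: sep; rewrite (inj_eq lift_inj).
have H0 : (0 < #|[set 1%g; c]|)%N by apply/card_gt0P; exists 1%g; rewrite !inE eqxx.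
have lt_p : (p * #|[set 1%g; c]| < #|{: G}|)%N by rewrite -cardG ltn_pmul2r.
pose xi k := (tau' k)^-1%g u0.
have xiu k : is_OK_unit (xi k) by apply: OK_unit_gal.
have xi0 k := OK_unit_neq0 (xiu k).
have [dxi _] := conj_logmx cE sep' lt_p u0u u0_contr.
rewrite -/xi in dxi; have dxi0 := lt0r_neq0 dxi.
have [N N0 span] := power_in_span cE sep cov xiu dxi0.
(* The exponents of [N]-th powers of units. This lattice contains [N] times each basis vector,
   because [xi i] is a unit. *)
pose P (v : 'rV[int]_p) := exists u, is_OK_unit u /\ eqt (u ^+ N) (mon xi v).
have PB x y : P x -> P y -> P (x - y).
  move=> [u [uu ux]] [v [vu vy]]; exists (u / v); split; first exact: OK_unit_div.
  by rewrite monB // exprMn exprVn; apply: eqtM => //; apply: eqtV.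
have PE0 i : P (row i (N%:Z%:M)).
  exists (xi i); split=> //; rewrite rowE mul_mx_scalar monZ // -exprnP.
  rewrite (_ : mon xi _ = xi i); first by apply: eqt_refl; rewrite expf_neq0.
  rewrite /mon (bigD1 i) //= big1 ?mulr1 => [|j ji]; rewrite mxE /=.
    by rewrite eqxx.
  by rewrite (negbTE ji).
have dE0 : \det (N%:Z%:M : 'M[int]_p) != 0.
  by rewrite det_scalar expf_neq0 // -lt0n.
have [E [PE dE Espan]] := sublattice_basis PB PE0 dE0.
have [e eP] := boolp.choice PE.
have eu i : is_OK_unit (e i) by case: (eP i).
have e0 i := OK_unit_neq0 (eu i).
have eE i : eqt (e i ^+ N) (mon xi (row i E)) by case: (eP i).
have de : \det (logmx tau' e) != 0.
  have : logmx tau' (fun i => e i ^+ N) = N%:R *: logmx tau' e.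
    by apply/matrixP=> i j; rewrite !mxE lgX // mulr_natl.
  rewrite (logmx_mon iota _ xi0 eE) => /(congr1 determinant) /eqP.
  rewrite det_mulmx detZ det_map_mx; apply: contraTneq => ->.
  by rewrite mulr0 mulf_neq0 // intr_eq0.
exists p, tau, e; split=> //; split=> //; split; first exact: (logmx_indep e0 de).
move=> u uu; apply/in_genE; split=> //.
have [v uv] := span u uu.
have [|k vk] := Espan v.
  by exists u; split=> //; rewrite uv; apply: eqt_refl; apply: mon_neq0.
(* Only the [N]-th powers have been compared; extracting an [N]-th root costs a root of unity. *)
exists k; apply: (root_of_unity_root N0); rewrite exprMn exprVn -mon_expr.
apply: (@eqt_trans _ (mon xi v)).
  by rewrite uv; apply: eqt_refl; apply: mon_neq0.
by rewrite vk mon_mulmx //; apply: mon_eqt => i; apply: eqt_sym.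
Qed.

End FundamentalSystem.

(** * The regulator as a determinant over the Galois group *)

Section Regulator.
Variables (L : splittingFieldType rat) (iota : {rmorphism L -> algC}).
Notation G := (GalQ L).
Notation lg := (lg iota).
Notation logmx := (logmx iota).
Variable c : G.
Hypothesis cE : forall x, iota (c x) = (iota x)^*.
Notation H := [set 1%g; c].

Lemma detRE n (M : 'I_n -> 'I_n -> R) : detR M = \det (\matrix_(i, j) M i j).
Proof.
rewrite /detR /determinant; apply: eq_bigr => s _.
congr (_ * _); first by case: odd_perm; rewrite ?expr1 ?expr0.
by apply: eq_bigr => i _; rewrite mxE.
Qed.

(** Every embedding is [iota] composed with an automorphism, so all embeddings are real or none is,
    according to whether [c = 1]. *)
Lemma loc_degE (t : {rmorphism L -> algC}) : loc_deg t = #|H|%:R.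
Proof.
have [s ts] := emb_gal iota t.
have realP : real_emb t <-> c = 1%g.
  split=> [tR|c1 x]; last by rewrite ts -cE c1 gal_id.
  apply: gal_ext => x; apply: (fmorph_inj iota); rewrite gal_id cE.
  by rewrite -[x](galKV s) -ts tR.
rewrite /loc_deg; case: (excluded_middle_informative (real_emb t)) => tR.
  by rewrite (proj1 realP tR) setUid cards1.
rewrite INRE cards2 (_ : 1%g != c) //.
by apply/eqP => h; apply: tR; apply/realP.
Qed.

Lemma distinct_placesE (s1 s2 : G) (t1 t2 : {rmorphism L -> algC}) :
  (forall x, t1 x = iota (s1 x)) -> (forall x, t2 x = iota (s2 x)) ->
  distinct_places t1 t2 <-> (s2^-1 * s1)%g \notin H.
Proof.
move=> t1E t2E; rewrite !inE negb_or; split.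
  case=> -[x xne] [y yne]; apply/andP; split; apply/eqP => h.
    by apply: xne; rewrite t1E t2E -[s1](mulKVg s2) h mulg1.
  by apply: yne; rewrite t1E t2E -[s1](mulKVg s2) h galME cE.
case/andP=> ne1 nec; split; apply: boolp.contrapT => no.
  case/eqP: ne1; rewrite (_ : s1 = s2) ?mulVg //; apply: gal_ext => x.
  apply: (fmorph_inj iota); apply: boolp.contrapT => ne; apply: no; exists x.
  by rewrite t1E t2E.
case/eqP: nec; rewrite (_ : s1 = (s2 * c)%g) ?mulKg //; apply: gal_ext => x.
apply: (fmorph_inj iota); apply: boolp.contrapT => ne; apply: no; exists x.
by rewrite t1E t2E -cE -galME.
Qed.

Lemma det_places n (tau : 'I_n -> G) (e : 'I_n -> L)
    (t : 'I_n -> {rmorphism L -> algC}) :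
  (forall i x, t i x = iota (tau i x)) ->
  detR (fun i j => Rmult (loc_deg (t i)) (ln (toR `|t i (e j)|))) =
    #|H|%:R ^+ n * \det (logmx tau e).
Proof.
move=> tE; rewrite detRE -detZ -[RHS]det_tr; congr (\det _).
by apply/matrixP=> i j; rewrite !mxE loc_degE tE.
Qed.

(** A fundamental system exists, so [epsilon] returns a genuine regulator value; the system and
    places extracted from it are those witnessing that value. *)
Lemma regulator_spec : exists r (e : 'I_r -> L) (tau : 'I_r -> G),
  [/\ fundamental_system e, separated c tau
    & regulator L = `|#|H|%:R ^+ r * \det (logmx tau e)|].
Proof.
have [r [e [t [fe [dt ->]]]]] : is_regulator L (regulator L).
  apply: epsilon_spec.
  have [p [tau [e [sep _ _ fe _]]]] := fundamental_system_exists cE.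
  pose t i : {rmorphism L -> algC} := iota \o tau (lift ord_max i).
  exists (Rabs (detR (fun i j => Rmult (loc_deg (t i)) (ln (toR `|t i (e j)|))))).
  exists p, e, t; split=> //; split=> // i j /eqP ij.
  apply/(distinct_placesE (s1 := tau (lift ord_max i)) (s2 := tau (lift ord_max j))) => //.
  by apply: sep; rewrite (inj_eq lift_inj).
have /boolp.choice[tau tauE] i := emb_gal iota (t i).
exists r, e, tau; split=> // [i j ij|].
  by apply/(distinct_placesE (tauE i) (tauE j))/dt/eqP.
by rewrite (det_places _ tauE) RabsE.
Qed.

End Regulator.

(** * Rounding to the nearest integer *)

Lemma floor_half_dist (F : archiRealFieldType) (x : F) :
  `|(Num.floor (x + 2^-1))%:~R - x| <= 2^-1.
Proof.
have := floor_le (x + 2^-1); have := floorD1_gt (x + 2^-1).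
rewrite intrD ler_norml; move: (_%:~R) => y h1 h2.
by apply/andP; split; lra.
Qed.

Lemma interval_center (F : realFieldType) (a d x : F) :
  `|x - (- (a / 2) - d)| <= a / 2 -> - (a + d) <= x <= - d.
Proof. by rewrite ler_norml => /andP[h1 h2]; apply/andP; split; lra. Qed.

(** * A contracting unit of small height *)

Section SmallContractingUnit.
Variables (L : splittingFieldType rat) (iota : {rmorphism L -> algC}).
Notation G := (GalQ L).
Notation lg := (lg iota).
Notation logmx := (logmx iota).
Variable c : G.
Hypothesis cE : forall x, iota (c x) = (iota x)^*.
Notation H := [set 1%g; c].

Lemma mem_mulc s : ((s * c)%g \in H) = (s \in H).
Proof.
apply/idP/idP; apply: contraLR; first exact: (mulc_notin cE).
by move/(mulc_notin cE); rewrite -mulgA (conj_galK cE) mulg1.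
Qed.

Lemma sum_H_const (f : G -> R) a :
  (forall s, s \in H -> f s = a) -> \sum_(s in H) f s = #|H|%:R * a.
Proof.
move=> fa; rewrite (eq_bigr (fun=> a)) // sumr_const mulr_natl.
by [].
Qed.

Lemma small_contracting_unit p (tau : 'I_p.+1 -> G) (eta : 'I_p -> L) :
  (0 < p)%N -> separated c tau -> (forall s, covered c tau s) ->
  (p.+1 * #|H|)%N = #|{: G}| -> (forall j, is_OK_unit (eta j)) ->
  \det (logmx (fun j => tau (lift ord_max j)) eta) != 0 ->
  exists k : 'rV[int]_p, contracting iota c (mon eta k) /\
    \sum_(s : G) Num.max 0 (lg s (mon eta k)) <=
      \sum_(s : G) \sum_j `|lg s (eta j)|.
Proof.
move=> p0 sep cov cardG etau d0; have eta0 j := OK_unit_neq0 (etau j).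
have nH0 : (0 < #|H|)%N by apply/card_gt0P; exists 1%g; rewrite !inE eqxx.
have H0 : 0 < #|H|%:R :> R by rewrite ltr0n.
have G0 : 0 < #|{: G}|%:R :> R by rewrite ltr0n -cardG muln_gt0.
have cardHC : #|{: G}| = (#|H| + #|~: H|)%N by rewrite cardsC.
have HC0 : 0 < #|~: H|%:R :> R.
  rewrite ltr0n -(ltn_add2l #|H|) -cardHC addn0 -cardG.
  by rewrite -[X in (X < _)%N]mul1n ltn_pmul2r.
have sumHC (a : R) : \sum_(s | s \notin H) a = #|~: H|%:R * a.
  rewrite (eq_bigl (fun s => s \in ~: H)) => [|s]; last by rewrite !inE.
  by rewrite sumr_const mulr_natl.
(* Values outside [H] can be prescribed freely; on [H] the vector is constant, with the value forced
   by the zero sum. *)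
have span_off (g : G -> R) : (forall s, g (s * c)%g = g s) ->
    exists t : 'I_p -> R, exists v : G -> R,
      [/\ forall s, v s = \sum_j t j * lg s (eta j),
          forall s, s \notin H -> v s = g s
        & #|H|%:R * v 1%g = - \sum_(s | s \notin H) g s].
  move=> gc; pose v s := if s \in H then - (\sum_(s | s \notin H) g s) / #|H|%:R else g s.
  have v1 : v 1%g = - (\sum_(s | s \notin H) g s) / #|H|%:R by rewrite /v !inE eqxx.
  have [||t tE] := log_span cE (v := v) sep cov etau d0.
  - by move=> s; rewrite /v mem_mulc gc.
  - rewrite (bigID (mem H)) /= (@sum_H_const _ (v 1%g)) => [|s sH]; last by rewrite v1 /v sH.
    rewrite v1 mulrC divfK ?gt_eqF // addrC; apply/eqP; rewrite subr_eq0; apply/eqP.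
    by apply: eq_bigr => s sH; rewrite /v (negbTE sH).
  exists t, v; split=> // [s sH|]; first by rewrite /v (negbTE sH).
  by rewrite v1 mulrC divfK // gt_eqF.
pose A s := \sum_j `|lg s (eta j)|.
have A_ge0 s : 0 <= A s by apply: sumr_ge0.
have Ac s : A (s * c)%g = A s by apply: eq_bigr => j _; rewrite (lg_mul_conj cE).
have sumA : \sum_(s in H) A s = #|H|%:R * A 1%g.
  apply: sum_H_const => s; rewrite !inE => /orP[] /eqP -> //.
  by rewrite -[c]mul1g Ac.
(* Otherwise every combination of the [eta j] vanishes at 1, whereas one equal to 1 outside [H] must
   be negative there. *)
have A1_gt0 : 0 < A 1%g.
  rewrite lt_neqAle A_ge0 andbT; apply/negP=> /eqP A1.
  have lg1 j : lg 1%g (eta j) = 0.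
    have /eqP := esym A1; rewrite psumr_eq0 // => /allP/(_ j).
    by rewrite mem_index_enum => /(_ isT); rewrite /= normr_eq0 => /eqP.
  have [t [v [vt _ v1]]] := span_off (fun=> 1) (fun=> erefl).
  move: v1; rewrite vt big1 => [|j _]; last by rewrite lg1 mulr0.
  by rewrite mulr0 sumHC mulr1 => /eqP; rewrite eq_sym oppr_eq0 gt_eqF.
(* Small enough that the total [#|~: H| * delta] is at most the sum of [A] over [H], which is the
   slack in the height bound. *)
pose delta := #|H|%:R * A 1%g / #|{: G}|%:R.
have delta_gt0 : 0 < delta by rewrite divr_gt0 ?mulr_gt0.
(* The target is the centre of [[-(A s + delta), -delta]]; rounding moves it by at most [A s / 2]
   and so stays in this interval. *)
have [|t [v [vt voff _]]] := span_off (fun s => - (A s / 2) - delta).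
  by move=> s; rewrite Ac.
pose k : 'rV[int]_p := \row_j Num.floor (t j + 2^-1); exists k.
have ku : is_OK_unit (mon eta k) by apply: mon_unit.
have lgk s : `|lg s (mon eta k) - v s| <= A s / 2.
  rewrite lg_mon // vt -sumrB; apply: le_trans (ler_norm_sum _ _ _) _.
  rewrite /A mulr_suml; apply: ler_sum => j _; rewrite -mulrBl normrM mulrC.
  rewrite ler_wpM2l // mxE.
  exact: floor_half_dist.
have lg_off s : s \notin H -> - (A s + delta) <= lg s (mon eta k) <= - delta.
  by move=> sH; have := lgk s; rewrite voff //; apply: interval_center.
have contr : contracting iota c (mon eta k).
  by move=> s /lg_off/andP[_ h]; apply: le_lt_trans h _; rewrite oppr_lt0.
split=> //; rewrite (contracting_height cE ku contr).
have := sum_lg iota ku; rewrite (bigID (mem H)) /=.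
rewrite (@sum_H_const _ (lg 1%g (mon eta k))) => [|s]; last first.
  by rewrite !inE => /orP[] /eqP -> //; rewrite -[c]mul1g (lg_mul_conj cE).
move/eqP; rewrite addr_eq0 => /eqP ->; rewrite -sumrN -/A.
apply: le_trans (_ : \sum_(s | s \notin H) (A s + delta) <= _).
  by apply: ler_sum => s /lg_off/andP[h _]; rewrite lerNl.
rewrite big_split /= sumHC [X in _ <= X](bigID (mem H)) /= addrC lerD2r sumA.
rewrite /delta mulrA ler_pdivrMr // mulrC ler_pM2l ?mulr_gt0 //.
by rewrite ler_nat cardHC leq_addl.
Qed.

End SmallContractingUnit.

(** * Subgroups generated by units, and their index *)

Section GeneratedSubgroup.
Variables (L : fieldExtType rat) (I : finType) (g : I -> L).
Hypothesis gu : forall i, is_OK_unit (g i).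

Lemma in_gen_eqt (x y : L) : is_OK_unit x -> eqt x y -> in_gen g y -> in_gen g x.
Proof.
move=> ux xy [_ [k yk]]; split=> //; exists k; exact: (eqt_trans xy yk).
Qed.

Lemma in_gen1 : in_gen g 1.
Proof.
split; first exact: OK_unit1.
exists (fun=> 0); rewrite big1 => [|i _]; last by rewrite expr0z.
exact: (eqt_refl (oner_neq0 _)).
Qed.

Lemma in_genM (x y : L) : in_gen g x -> in_gen g y -> in_gen g (x * y).
Proof.
case=> ux [k xk] [uy [l yl]]; split; first exact: OK_unitM.
exists (fun i => k i + l i).
rewrite (_ : \prod_i _ = (\prod_i g i ^ k i) * (\prod_i g i ^ l i)).
  exact: eqtM.
by rewrite -big_split; apply: eq_bigr => i _; rewrite expfzDr ?OK_unit_neq0.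
Qed.

Lemma in_genV (x : L) : in_gen g x -> in_gen g x^-1.
Proof.
case=> ux [k xk]; split; first exact: OK_unitV.
exists (fun i => - k i); rewrite (_ : \prod_i _ = (\prod_i g i ^ k i)^-1).
  exact: eqtV.
by rewrite -prodfV; apply: eq_bigr => i _; rewrite invr_expz.
Qed.

Lemma in_genXz (x : L) (n : int) : in_gen g x -> in_gen g (x ^ n).
Proof.
move=> gx; have gX m : in_gen g (x ^+ m).
  by elim: m => [|m IHm]; [exact: in_gen1 | rewrite exprS; apply: in_genM].
by case: n => m; [exact: gX | apply/in_genV/gX].
Qed.

Lemma in_gen_mon n (y : 'I_n -> L) (k : 'rV[int]_n) :
  (forall i, in_gen g (y i)) -> in_gen g (mon y k).
Proof.
move=> gy; apply: (big_ind (in_gen g)); [exact: in_gen1 | exact: in_genM |].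
by move=> i _; apply: in_genXz.
Qed.

Lemma in_gen_gen i : in_gen g (g i).
Proof.
split=> //; exists (fun j => (j == i)%:Z); rewrite (bigD1 i) //= big1 ?mulr1.
  by rewrite eqxx expr1z; apply/eqt_refl/OK_unit_neq0.
by move=> j /negbTE ->; rewrite expr0z.
Qed.

(* [int_cosets_cover] gives [|det M|] cosets of the subgroup generated by the
   [y i], which lies in the subgroup generated by the [g i]. *)
Lemma has_index_le n (e y : 'I_n -> L) (M : 'M[int]_n) :
  fundamental_system e -> (forall i, eqt (y i) (mon e (row i M))) ->
  (forall i, in_gen g (y i)) -> \det M != 0 ->
  exists2 m, (m <= `|\det M|)%N & has_index (in_gen g) m.
Proof.
move=> [eu [_ eg]] yM gy dM; have e0 i := OK_unit_neq0 (eu i).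
have [reps repsP] := int_cosets_cover dM.
apply: (has_index_cover (u := fun i => mon e (reps i))) => [x y'|i|x ux].
- exact: in_genM.
- exact: mon_unit.
have /in_genE[_ [v xv]] := eg x ux; have [i [k vE]] := repsP v; exists i.
apply: (in_gen_eqt (y := mon y k)); last exact: in_gen_mon.
  by apply: OK_unit_div => //; apply: mon_unit.
have re := mon_neq0 (reps i) e0.
apply: (@eqt_trans _ (mon e (k *m M))); last first.
  by rewrite mon_mulmx //; apply: mon_eqt => j; apply: eqt_sym.
rewrite (_ : mon e (k *m M) = mon e v / mon e (reps i)).
  by apply: eqtM => //; apply/eqtV/eqt_refl.
by rewrite vE monD // mulrC mulKf.
Qed.

End GeneratedSubgroup.

Theorem theorem1p1 (L : splittingFieldType rat) (iota : {rmorphism L -> algC})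
  (r : nat) (hr : unit_rank L r) (r_pos : (0 < r)%N)
  (eta : 'I_r -> L) (eta_unit : forall j, is_OK_unit (eta j)) (eta_indep : mult_indep eta) :
  exists beta : L,
    [/\ in_gen eta beta, minkowski_unit r beta,
        Rle (weil_h iota beta) (Rmult (INR 2) (\big[Rplus/R0]_(j < r) weil_h iota (eta j)))
      & exists n : nat, has_index (in_gen (fun s : GalQ L => s beta)) n /\
          Rle (Rmult (@regulator L) (INR n))
              (pow (Rmult (INR (\dim (fullv : {vspace L}))) (weil_h iota beta)) r)].
Proof.
have [c cE] := complex_conj_gal iota.
have [p [tau [e [sep cov cardG fe de]]]] := fundamental_system_exists cE.
have rp : r = p := unit_rank_fundamental hr fe.
subst p; pose tau' j := tau (lift ord_max j).
have [eu [ei eg]] := fe; have e0 i := OK_unit_neq0 (eu i).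
have [M etaM] := in_gen_rows (fun i => eg _ (eta_unit i)).
have dM : \det M != 0.
  apply: int_free_det; exact: (mult_indep_free (N := 1) eta_indep isT e0 etaM).
have deta : \det (logmx iota tau' eta) != 0.
  rewrite (logmx_mon iota _ e0 etaM) det_mulmx det_map_mx.
  by apply: mulf_neq0 de; rewrite /= intr_eq0.
have [k [contr small]] := small_contracting_unit cE r_pos sep cov cardG eta_unit deta.
set beta := mon eta k in contr small.
have bu : is_OK_unit beta by apply: mon_unit.
have sbu (s : GalQ L) : is_OK_unit (s beta) by apply: OK_unit_gal.
have H0 : (0 < #|[set 1%g; c]|)%N by apply/card_gt0P; exists 1%g; rewrite !inE eqxx.
have lt_r : (r * #|[set 1%g; c]| < #|{: GalQ L}|)%N by rewrite -cardG ltn_pmul2r.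
have sep' : separated c tau'.
  by move=> i j ij; apply: sep; rewrite (inj_eq lift_inj).
have d0 : 0 < (\dim {:L})%:R :> R.
  by rewrite ltr0n -(card_galQ iota) (leq_ltn_trans _ lt_r).
exists beta; split.
- by apply/in_genE; split=> //; exists k; apply/eqt_refl/OK_unit_neq0.
(* The rank is at most that of all units; the [r] conjugates along [tau'] attain it. *)
- split=> //; split; last by move=> y yP; apply: hr.2 => j; case: (yP j).
  exists (fun i => (tau' i)^-1%g beta); split=> [j|].
    exact: (in_gen_gen sbu).
  apply: (logmx_indep (iota := iota) (tau := tau')) => [i|].
    exact: OK_unit_neq0.
  by rewrite gt_eqF //; have [] := conj_logmx cE sep' lt_r bu contr.
- apply/RleP; rewrite RmultE INRE.
  rewrite (_ : \big[Rplus/R0]_(j < r) _ = \sum_(j < r) weil_h iota (eta j)) //.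
  rewrite -(ler_pM2l d0) weil_hE; apply: le_trans small _.
  (* Each [eta j] contributes the sum of its [|lg s (eta j)|], that is [2 d h(eta j)]: this is the
     factor 2. *)
  rewrite exchange_big /= !mulr_sumr; apply: ler_sum => j _.
  by rewrite -(weil_h_unit iota (eta_unit j)) [X in _ <= X]mulrA [_ * 2]mulrC.
(* The regulator comes with its own system [f] and places [sigma], so conjugates of [beta] are now
   taken along [sigma]. *)
have [r' [f [sigma [ff sepf ->]]]] := regulator_spec cE.
have rr' : r' = r := fundamental_system_size ff fe.
subst r'; have [fu [fi fg]] := ff; have f0 i := OK_unit_neq0 (fu i).
pose y i := (sigma i)^-1%g beta.
have [N yN] := in_gen_rows (fun i => fg (y i) (sbu _)).
have [dy dy_le] := conj_logmx cE sepf lt_r bu contr.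
have detE : \det (logmx iota sigma y) = (\det N)%:~R * \det (logmx iota sigma f).
  by rewrite (logmx_mon iota _ f0 yN) det_mulmx det_map_mx.
have dN : \det N != 0.
  by apply: contraTneq dy => N0; rewrite detE N0 mul0r ltxx.
have gy i : in_gen (fun s : GalQ L => s beta) (y i) by apply: (in_gen_gen sbu).
have [n nN nP] := has_index_le sbu ff yN gy dN.
exists n; split=> //; apply/RleP; rewrite RpowE !RmultE !INRE weil_hE.
(* Since [n <= |det N|], the left side is at most [#|H|^r |det N| |det (logmx f)|], which is
   [#|H|^r det (logmx y)]. *)
apply: le_trans dy_le; rewrite -/y -[X in _ <= _ * X]gtr0_norm //.
rewrite normrM -mulrA detE normrM ger0_norm ?exprn_ge0 //.
rewrite ler_pM2l ?exprn_gt0 ?ltr0n // mulrC ler_wpM2r //.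
by rewrite -intr_norm -abszE ler_nat.
Qed.
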